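(* Let $Q_t$ be the number in system at time $t$ of an $M^N/M/\infty$ queue, i.e. an infinite server queue with stationary batch arrival rate $\lambda>0$, random batch sizes given by an i.i.d. sequence of non-negative integer valued random variables $\{N_i\mid i\in\mathbb{Z}^+\}$, and exponentially distributed service at rate $\mu>0$. Then the steady-state number in system $Q_\infty$ satisfies $$Q_\infty\stackrel{D}{=}\sum_{j=1}^\infty jY_j,$$ where the $Y_j\sim\mathrm{Pois}\left(\frac{\lambda}{j\mu}\bar F_N(j)\right)$ are independent and $\bar F_N(j)=\mathbb{P}(N_1\ge j)$.
   Context: Model: batches arrive at the epochs of a Poisson process of rate $\lambda$, the $i$-th batch bringing $N_i$ customers simultaneously. There are infinitely many servers, so each customer starts service immediately and leaves after an independent $\mathrm{Exp}(\mu)$ service time; arrival epochs, batch sizes and services are mutually independent. $Q_t$ is the number of customers present at time $t$, and $Q_\infty$ denotes a random variable with the limiting distribution of $Q_t$ as $t\to\infty$ (starting from an empty system). $\mathrm{Pois}(0)$ is the point mass at $0$; if the sum is infinite the identity is read in $\{0,1,2,\dots\}\cup\{\infty\}$. *)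

(* Defs.v *)
From HB Require Import structures.
From mathcomp Require Import all_boot all_order all_algebra finmap.
From mathcomp Require Import all_classical all_reals all_analysis.
From mathcomp Require Import measurable_realfun.

Set Implicit Arguments.
Unset Strict Implicit.
Unset Printing Implicit Defensive.

Import Order.TTheory GRing.Theory Num.Theory.
Import numFieldNormedType.Exports.

Local Open Scope classical_set_scope.
Local Open Scope ring_scope.

(* The family (F i)_(i in I0) of systems of events is mutually independent:
   the product rule holds for every finite subfamily. *)
Definition mutual_independence d (T : measurableType d) (R : realType)
    (P : probability T R) (I : choiceType) (I0 : set I)
    (F : I -> set_system T) : Prop :=
  forall J : {fset I}, [set` J] `<=` I0 ->
  forall A : I -> set T, (forall i, i \in J -> F i (A i)) ->
    P (\bigcap_(i in [set` J]) A i) = (\prod_(i <- J) P (A i))%E.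

(* Restricted to measurable sets because library laws such as
   exponential_prob are total set functions, also defined (with no
   probabilistic meaning) on non-measurable sets. *)
Definition has_law d d' (T : measurableType d) (T' : measurableType d')
    (R : realType) (P : probability T R) (X : {RV P >-> T'})
    (m : set T' -> \bar R) : Prop :=
  forall A : set T', measurable A -> distribution P X A = m A.

(* The second argument of poisson_prob is not used in its definition; for rate
   0, poisson_prob is the point mass at 0. *)
Definition Pois (R : realType) (rate : R) : set nat -> \bar R :=
  poisson_prob rate 0.

(* Equality in distribution of two variables that may live on different
   probability spaces. *)
Definition eq_law d1 d2 d' (T1 : measurableType d1) (T2 : measurableType d2)
    (T' : measurableType d') (R : realType) (P1 : probability T1 R)
    (P2 : probability T2 R) (X1 : T1 -> T') (X2 : T2 -> T') : Prop :=
  forall A : set T', measurable A ->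
    pushforward P1 X1 A = pushforward P2 X2 A.

Section batch_queue.
Context d (T : measurableType d) (R : realType) (P : probability T R).
Variables (tau : nat -> {RV P >-> R}) (N : nat -> {RV P >-> nat})
  (S : nat -> nat -> {RV P >-> R}).

(* Batches are numbered from 0.  Batch i brings N i customers, numbered
   0, ..., N i - 1; S i k is the service time of customer k of batch i, and
   tau i is the time between the arrivals of batches i - 1 and i (between
   time 0 and the first arrival for i = 0). *)

(* The sigma-algebras generated by all the variables driving the queue. *)
Definition queue_sigma (x : (nat + nat) + (nat * nat)) : set_system T :=
  match x with
  | inl (inl i) => g_sigma_algebra_preimage (tau i)
  | inl (inr i) => g_sigma_algebra_preimage (N i)
  | inr (i, k) => g_sigma_algebra_preimage (S i k)
  end.

(* The arrival epochs form a Poisson process of rate lambda, i.e. the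
   interarrival times are i.i.d. exponential. *)
Record MNMinfty_queue (lambda mu : R) : Prop := {
  interarrival_law : forall i, has_law (tau i) (exponential_prob lambda) ;
  batch_size_law : forall i, has_law (N i) (distribution P (N 0%N)) ;
  service_law : forall i k, has_law (S i k) (exponential_prob mu) ;
  primitives_independent : mutual_independence P setT queue_sigma }.

Definition arrival_epoch (i : nat) (w : T) : R := \sum_(k < i.+1) tau k w.

Definition present (t : R) (i k : nat) (w : T) : bool :=
  arrival_epoch i w <= t < arrival_epoch i w + S i k w.

(* The value +oo is possible only on the null event that infinitely many
   batches arrive by time t. *)
Definition number_in_system (t : R) (w : T) : \bar R :=
  (\sum_(0 <= i <oo) (\sum_(k < N i w | present t i k w) 1%R)%:E)%E.

Definition batch_tail (j : nat) : R := fine (P [set w | (j <= N 0%N w)%N]).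

End batch_queue.

(* sum_(j >= 1) j Y_j, computed in [0, +oo]; Y 0 is not used. *)
Definition weighted_sum (T : Type) (R : realType) (Y : nat -> T -> nat)
    (w : T) : \bar R :=
  (\sum_(1 <= j <oo) (j * Y j w)%:R%:E)%E.

(* Z is a {0, 1, 2, ...} u {+oo}-valued variable whose law is the limit of the
   laws of the variables Q t as t tends to +oo.  Any mass lost in the limit
   sits at +oo: this is weak convergence on the one-point compactification of
   {0, 1, 2, ...}. *)
Definition limiting_distribution d d' (T : measurableType d)
    (T' : measurableType d') (R : realType) (P : probability T R)
    (P' : probability T' R) (Q : R -> T -> \bar R) (Z : T' -> \bar R) : Prop :=
  (forall w, Z w = +oo%E \/ exists n : nat, Z w = n%:R%:E) /\
  (forall n : nat, P (Q t @^-1` [set n%:R%:E]) @[t --> +oo] -->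
                   P' (Z @^-1` [set n%:R%:E])).

(* Main.v *)
Require Import Defs.
From HB Require Import structures.
From mathcomp Require Import all_boot all_order all_algebra finmap.
From mathcomp Require Import all_classical all_reals all_analysis.
From mathcomp Require Import measurable_realfun ring lra.

Set Implicit Arguments.
Unset Strict Implicit.
Unset Printing Implicit Defensive.

Import Order.TTheory GRing.Theory Num.Theory.
Import numFieldNormedType.Exports.

Local Open Scope classical_set_scope.
Local Open Scope ring_scope.

(** The proof compares probability generating functions. Fix 0 < z < 1, write
    x(u) = 1 - (1 - z) exp(- mu u) for the generating function of the number
    (0 or 1) of customers still present u after one arrival, and h for the
    generating function of the batch size. A batch that arrived u ago then
    contributes the factor h(x(u)), and the Poisson arrivals give

      E z^(Q_t) = exp (- lambda int_0^t (1 - h(x(u))) du).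

    As x' = mu (1 - x) and (1 - h(x)) / (1 - x) = sum_(j >= 1) b_j x^(j - 1),
    with b_j = P(N >= j), the integral has the closed form
    (L(x(t)) - L(z)) / mu, where L(x) = sum_(j >= 1) b_j x^j / j (lemmas
    [tail_series] and [derive_log_series]). For t tending to infinity, x(t)
    tends to 1 and the monotone limit [log_series_abel] is

      exp (- sum_(j >= 1) lambda / (j mu) b_j (1 - z^j)),

    which is the generating function of sum_j j Y_j, factor by factor
    ([pgf_weighted_count]). This remains valid when sum_j b_j / j is
    infinite: both sides then vanish on ]0, 1[, that is, all the mass is at
    infinity.

    The formula for E z^(Q_t) is verified rather than derived. Let G(u) be its
    right-hand side at u >= 0, let G(u) = 1 for u < 0, and let A_n be the
    arrival epoch of the n-th batch. The product of the factors of the first n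
    batches times G(t - A_n) has expectation G(t) for every n
    ([queue_pgf_martingale]): the variables of the last batch are integrated
    out one after the other, services first, then the batch size
    ([peel_batch]), then the interarrival time ([peel_arrival]), where the
    differential equation G' = - lambda (1 - h(x)) G makes G a fixed point of
    the renewal step ([exponential_renewal]). Once A_n > t the last factor is
    1, and P(A_n <= t) tends to 0 geometrically, by Markov's inequality for
    exp(- A_n).

    Integrating out one variable given all the others is Fubini's theorem for
    the joint law of this variable and the sigma-algebra generated by the
    others ([peel_inner], [peel_outer]), which is a product by the pi-lambda
    theorem ([independent_of_others]).

    Convergence of generating functions on ]0, 1[ yields convergence of each
    point mass, hence the limit law, by an elementary induction
    ([pgf_continuity]). As a law on the naturals with a point at infinity is
    determined by its finite point masses, the limit is unique
    ([eq_law_atoms]). *)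

(** * Independence and integration of one variable *)

Section grouping.
Context d (T : measurableType d) (R : realType) (P : probability T R)
  (I : choiceType) (I0 : set I) (F : I -> set_system T).
Hypotheses (indepF : mutual_independence P I0 F)
  (FT : forall i, F i setT) (FI : forall i, setI_closed (F i))
  (Fm : forall i, F i `<=` measurable).

(** A pi-system that generates the sigma-algebra of the family (F i)_(i in J),
    and on which mutual independence is given by the product rule. *)
Definition cylinders (J : set I) : set_system T :=
  [set A | exists (K : {fset I}) (B : I -> set T),
     [/\ [set` K] `<=` J, forall i, i \in K -> F i (B i) &
         A = \bigcap_(i in [set` K]) B i]].

Lemma cylinders_measurable J : cylinders J `<=` measurable.
Proof.
move=> _ [K [B [_ FB ->]]]; apply: fin_bigcap_measurable => // i iK.
exact/Fm/FB.
Qed.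

Lemma sigma_cylinders_measurable J : <<s cylinders J >> `<=` measurable.
Proof.
apply: smallest_sub; [exact: sigma_algebra_measurable|
  exact: cylinders_measurable].
Qed.

Lemma setI_closed_cylinders J : setI_closed (cylinders J).
Proof.
move=> _ _ [K [B [KJ FB ->]]] [L [C [LJ FC ->]]].
exists (K `|` L)%fset, (fun i => (if i \in K then B i else setT) `&`
  (if i \in L then C i else setT)); split.
- by move=> i /=; rewrite inE => /orP[/KJ|/LJ].
- move=> i _; apply: FI; case: ifPn => ?;
    first [exact: FB|exact: FC|exact: FT].
- apply/seteqP; split=> [w [Bw Cw] i _|w BCw].
    by split; case: ifPn => // ?; [exact: Bw|exact: Cw].
  by split=> i /= iK; have := BCw i; rewrite /= inE iK ?orbT => /(_ isT)[].
Qed.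

Lemma cylindersW (J : set I) i B : J i -> F i B -> cylinders J B.
Proof.
move=> Ji FB; exists [fset i]%fset, (fun=> B); split.
- by move=> j /=; rewrite inE => /eqP ->.
- by move=> j; rewrite inE => /eqP ->.
- apply/seteqP; split=> [w Bw j _ //|w]; apply; by rewrite /= inE.
Qed.

(** Both sides are finite measures in A that agree on the cylinders, where the
    claim is the product rule for one more index. *)
Lemma independent_of_others (J : set I) i B A : I0 i -> J `<=` I0 -> ~ J i ->
  F i B -> <<s cylinders J >> A -> P (B `&` A) = (P B * P A)%E.
Proof.
move=> I0i JI0 Ji FB.
have mB : measurable B by exact: (Fm FB).
have nPB : (0 <= fine (P B))%R by rewrite fine_ge0.
pose m1 := mrestr P mB; pose m2 := mscale (NngNum nPB) P.
have PBE : (fine (P B))%:E = P B by rewrite fineK// fin_num_measure.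
suff H : forall X, <<s cylinders J >> X -> m1 X = m2 X.
  by move=> /H; rewrite /m1 /m2 /mrestr /mscale/= PBE setIC.
have trE : [set X | cylinders J X /\ X `<=` setT] = cylinders J.
  by apply/seteqP; split=> [X []|X ?].
have H2 := g_sigma_algebra_measure_unique_trace (cylinders J) setT measurableT.
rewrite trE in H2.
apply: H2 => //.
- exact: cylinders_measurable.
- exact: setI_closed_cylinders.
- change (P (setT `&` B) = (fine (P B))%:E * P setT)%E.
  by rewrite setTI probability_setT mule1 PBE.
- move=> _ [K [C [KJ FC ->]]].
  have iK : i \notin K by apply/negP => /KJ.
  change (P (\bigcap_(j in [set` K]) C j `&` B) =
    (fine (P B))%:E * P (\bigcap_(j in [set` K]) C j))%E.
  rewrite PBE.
  have := @indepF (i |` K)%fset.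
  move=> /(_ _ (fun j => if j == i then B else C j)).
  rewrite big_fsetU1//= eqxx set_fsetU1 bigcap_setU1 eqxx.
  have -> : \bigcap_(j in [set` K]) (if j == i then B else C j) =
      \bigcap_(j in [set` K]) C j.
    apply: eq_bigcapr => j /= jK; case: eqP => // ji.
    by move: iK; rewrite -ji jK.
  move=> H3; rewrite setIC H3.
  + congr (_ * _)%E; rewrite (@indepF K) => //.
      apply: eq_big_seq => j jK; case: eqP => // ji.
      by move: iK; rewrite -ji jK.
    exact: subset_trans KJ JI0.
  + by move=> j /= [->//|/KJ/JI0].
  + by move=> j; rewrite !inE; case: eqP => [-> //|_ /=]; exact: FC.
- change (P (setT `&` B) < +oo)%E.
  by rewrite setTI ltey_eq fin_num_measure.
Qed.
End grouping.

Section integrate_out.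
Context d (T : measurableType d) (R : realType) (P : probability T R)
  d' (T' : measurableType d') (X : {RV P >-> T'}) (G : set_system T).
Hypotheses (Gm : <<s G >> `<=` measurable)
  (XG : forall B A, measurable B -> <<s G >> A ->
    P (X @^-1` B `&` A) = (P (X @^-1` B) * P A)%E).
Variable g : T' * g_sigma_algebraType G -> \bar R.
Hypotheses (mg : measurable_fun setT g) (g0 : forall x, (0 <= g x)%E).

(* The identity of T, as a random element of the space T equipped with the
   sigma-algebra generated by G: it carries all the information of G. *)
Let idG (w : T) : g_sigma_algebraType G := w.
Let midG : measurable_fun setT idG.
Proof. by move=> _ A mA; rewrite setTI; exact: Gm. Qed.
HB.instance Definition _ := isMeasurableFun.Build _ _ _ _ idG midG.
Let pairG (w : T) : T' * g_sigma_algebraType G := (X w, idG w).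
Let mpairG : measurable_fun setT pairG.
Proof. by apply/measurable_fun_pair. Qed.
HB.instance Definition _ := isMeasurableFun.Build _ _ _ _ pairG mpairG.

Let lawE (f : g_sigma_algebraType G -> \bar R) : measurable_fun setT f ->
  (forall w, 0 <= f w)%E -> (\int[distribution P idG]_w f w = \int[P]_w f w)%E.
Proof. by move=> mf f0; rewrite ge0_integral_pushforward. Qed.

(* Independence of X and G: the law of the pair (X, idG) is a product. *)
Let jointE : (\int[P]_w g (X w, w) =
  \int[distribution P X \x distribution P idG]_p g p)%E.
Proof.
transitivity (\int[distribution P pairG]_p g p)%E.
  by rewrite ge0_integral_pushforward.
apply: eq_measure_integral => A mA _; apply/esym.
by apply: product_measure_unique => // B C mB mC; exact: XG.
Qed.

(** The variable v carries an independent copy of X: the value of X may be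
    averaged while the information of G is kept fixed. *)
Lemma integrate_out_inner : (\int[P]_w g (X w, w) =
  \int[P]_w \int[P]_v g (X v, w))%E.
Proof.
rewrite jointE fubini_tonelli2// lawE//.
- apply: eq_integral => w _; rewrite /fubini_G ge0_integral_distribution//.
  exact: (measurable_fun_pair1 (T2 := g_sigma_algebraType G) w mg).
- exact: (measurable_fun_fubini_tonelli_G g).
- by move=> w; exact: integral_ge0.
Qed.

Lemma integrate_out_outer : (\int[P]_w g (X w, w) =
  \int[P]_v \int[P]_w g (X v, w))%E.
Proof.
have mx x : measurable_fun setT (fun w => g (x, w)).
  exact: (measurableT_comp mg (pair1_measurable x)).
rewrite jointE fubini_tonelli1// ge0_integral_distribution//.
- by apply: eq_integral => w _; rewrite /= /fubini_F lawE.
- exact: (measurable_fun_fubini_tonelli_F g).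
- by move=> x; exact: integral_ge0.
Qed.

End integrate_out.

Section preimage_system.
Context d (T : measurableType d) d' (T' : measurableType d') (X : T -> T').

Lemma g_sigma_algebra_preimage_setT : g_sigma_algebra_preimage X setT.
Proof. by exists setT => //; rewrite preimage_setT setTI. Qed.

Lemma setI_closed_g_sigma_algebra_preimage :
  setI_closed (g_sigma_algebra_preimage X).
Proof.
move=> _ _ [A mA <-] [B mB <-]; exists (A `&` B); first exact: measurableI.
by rewrite !setTI preimage_setI.
Qed.

Lemma g_sigma_algebra_preimage_measurable : measurable_fun setT X ->
  g_sigma_algebra_preimage X `<=` measurable.
Proof. by move=> mX _ [A mA <-]; exact: mX. Qed.

End preimage_system.

(** The preimage of a set is the union over n of the products of {n} with its
    preimage under f n. *)
Lemma measurable_fun_nat_pair d (T : measurableType d)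
    d' (T' : measurableType d') (f : nat -> T -> T') :
  (forall n, measurable_fun setT (f n)) ->
  measurable_fun setT (fun p : nat * T => f p.1 p.2).
Proof.
move=> mf _ B mB; rewrite setTI.
have -> : (fun p : nat * T => f p.1 p.2) @^-1` B =
    \bigcup_n ([set n] `*` (f n @^-1` B)).
  apply/seteqP; split=> [[n w] /= fB|[n w] [k _ [/= -> //]]].
  by exists n.
apply: bigcupT_measurable => n; apply: measurableX => //.
by rewrite -[X in measurable X]setTI; exact: mf.
Qed.

(** Used for products with a random number of factors. *)
Lemma measurable_fun_nat_comp d (T : measurableType d)
    d' (T' : measurableType d') (f : nat -> T -> T') (N : T -> nat) :
  measurable_fun setT N -> (forall n, measurable_fun setT (f n)) ->
  measurable_fun setT (fun w => f (N w) w).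
Proof.
move=> mN mf; apply: (measurableT_comp (measurable_fun_nat_pair mf)
  (g := fun w => (N w, w))).
exact/measurable_fun_pair.
Qed.

Lemma measurable_sum_nat d (T : measurableType d) m (f : nat -> T -> nat) :
  (forall k, (k < m)%N -> measurable_fun setT (f k)) ->
  measurable_fun setT (fun w => \sum_(k < m) f k w)%N.
Proof.
elim: m => [|m ih] mf.
  rewrite (_ : (fun w => _) = cst 0%N); first exact: measurable_cst.
  by apply/funext => w; rewrite big_ord0.
rewrite (_ : (fun w => _) = (fun w => \sum_(k < m) f k w + f m w)%N).
  by apply: measurable_fun_addn; [apply: ih => k km; exact/mf/leqW|exact: mf].
by apply/funext => w; rewrite big_ord_recr.
Qed.

Section peel.
Context d (T : measurableType d) (R : realType) (P : probability T R)
  (I : choiceType) (I0 : set I) (F : I -> set_system T).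
Hypotheses (indepF : mutual_independence P I0 F)
  (FT : forall i, F i setT) (FI : forall i, setI_closed (F i))
  (Fm : forall i, F i `<=` measurable).

(** The sample space, with the information of every variable but the i-th. *)
Definition othersType (i : I) := g_sigma_algebraType (cylinders F (I0 `\ i)).

Lemma measurable_fun_others d' (T' : measurableType d') (i j : I)
    (X : T -> T') :
  I0 j -> j != i -> F j = g_sigma_algebra_preimage X ->
  measurable_fun setT (X : othersType i -> T').
Proof.
move=> I0j ji FX _ B mB; apply: sub_sigma_algebra.
apply: (@cylindersW _ _ _ _ _ j); first by split=> //; exact/eqP.
by rewrite FX; exists B.
Qed.

(* In the two lemmas below, v carries an independent copy of the i-th variable,
   which is integrated out first or last. *)
Variables (i : I) (I0i : I0 i) (d' : measure_display) (T' : measurableType d')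
  (X : {RV P >-> T'}) (FX : F i = g_sigma_algebra_preimage X).
Variable g : T' -> T -> \bar R.
Hypotheses
  (mg : measurable_fun setT (fun p : T' * othersType i => g p.1 p.2))
  (g0 : forall x w, (0 <= g x w)%E).

Let X_others (B : set T') (A : set T) : measurable B ->
  <<s cylinders F (I0 `\ i) >> A ->
  P (X @^-1` B `&` A) = (P (X @^-1` B) * P A)%E.
Proof.
move=> mB GA.
apply: (independent_of_others indepF FT FI Fm I0i _ _ _ GA).
- by move=> j [].
- by move=> [_ /(_ erefl)].
- by rewrite FX; exists B => //; rewrite setTI.
Qed.

Lemma peel_inner :
  (\int[P]_w g (X w) w = \int[P]_w \int[P]_v g (X v) w)%E.
Proof.
apply: (integrate_out_inner _ X_others mg (fun p => g0 p.1 p.2)).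
exact: sigma_cylinders_measurable.
Qed.

Lemma peel_outer :
  (\int[P]_w g (X w) w = \int[P]_v \int[P]_w g (X v) w)%E.
Proof.
apply: (integrate_out_outer _ X_others mg (fun p => g0 p.1 p.2)).
exact: sigma_cylinders_measurable.
Qed.

End peel.

(** * Generating functions of counts *)

Section pgf.
Context d (T : measurableType d) (R : realType) (P : probability T R).

Lemma integral_prob_cst (c : R) : (\int[P]_w c%:E = c%:E)%E.
Proof. by rewrite integral_cst//= probability_setT mule1. Qed.

Definition pgf (N : T -> nat) (z : R) : R := fine (\int[P]_w (z ^+ N w)%:E)%E.

Definition nat_pmf (Q : T -> \bar R) (k : nat) : R :=
  fine (P (Q @^-1` [set k%:R%:E])).

Lemma measurable_exprn_nat (N : T -> nat) (z : R) : measurable_fun setT N ->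
  measurable_fun setT (fun w => z ^+ N w).
Proof. by move=> mN; apply: (measurableT_comp (f := fun n => z ^+ n)). Qed.

Lemma pgfE (N : T -> nat) z : measurable_fun setT N -> 0 <= z <= 1 ->
  (\int[P]_w (z ^+ N w)%:E = (pgf N z)%:E)%E.
Proof.
move=> mN /andP[z0 z1]; rewrite /pgf fineK//.
have le1 : (\int[P]_w (z ^+ N w)%:E <= 1)%E.
  have -> : (1 = \int[P]_w 1%:E)%E.
    by rewrite integral_prob_cst.
  apply: ge0_le_integral => //.
  - by move=> w _; rewrite lee_fin exprn_ge0.
  - exact/measurable_EFinP/measurable_exprn_nat.
  - by move=> w _; rewrite lee_fin exprn_ile1.
rewrite ge0_fin_numE ?(le_lt_trans le1) ?ltry//.
by apply: integral_ge0 => w _; rewrite lee_fin exprn_ge0.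
Qed.

(** Pointwise, z ^ N exceeds the terms with N < m by at most z ^ m. This
    estimate replaces the power series expansion of the generating function,
    and also makes sense for counts that may be infinite. *)
Lemma pgf_partial_sum (N : T -> nat) (z : R) (m : nat) :
  measurable_fun setT N -> 0 <= z <= 1 ->
  0 <= pgf N z - \sum_(k < m) fine (P (N @^-1` [set nat_of_ord k])) * z ^+ k
    <= z ^+ m.
Proof.
move=> mN /andP[z0 z1].
pose S w := \sum_(k < m) \1_(N @^-1` [set nat_of_ord k]) w * z ^+ k.
have mA (k : nat) : measurable (N @^-1` [set k]).
  by rewrite -[X in measurable X]setTI; exact: mN.
have SE w : S w = if (N w < m)%N then z ^+ N w else 0.
  rewrite /S; case: ifPn => [Nm|]; last first.
    rewrite -leqNgt => mN'; apply: big1 => k _.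
    rewrite indicE memNset ?mul0r//= => Nk.
    by move: mN'; rewrite Nk leqNgt ltn_ord.
  rewrite (bigD1 (Ordinal Nm))//= indicE mem_set// mul1r big1 ?addr0// => k.
  move=> /eqP kN; rewrite indicE memNset ?mul0r//= => Nk.
  by apply: kN; apply/val_inj.
have S0 w : 0 <= S w by rewrite SE; case: ifP; rewrite ?exprn_ge0.
have mS : measurable_fun setT S.
  by apply: measurable_sum => k; apply: measurable_funM.
have IS : (\int[P]_w (S w)%:E =
    (\sum_(k < m) fine (P (N @^-1` [set nat_of_ord k])) * z ^+ k)%:E)%E.
  rewrite -sumEFin; under eq_integral do rewrite -sumEFin.
  rewrite ge0_integral_sum//; last 2 first.
  - by move=> k; apply/measurable_EFinP; exact: measurable_funM.
  - by move=> k w _; rewrite lee_fin mulr_ge0// exprn_ge0.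
  apply: eq_bigr => k _; under eq_integral do rewrite EFinM muleC.
  rewrite ge0_integralZl//; last 2 first.
  - exact/measurable_EFinP/measurable_indic.
  - by rewrite lee_fin exprn_ge0.
  by rewrite integral_indic// setIT EFinM muleC fineK// fin_num_measure.
have mz : measurable_fun setT (fun w => z ^+ N w).
  exact: measurable_exprn_nat.
have z01 : 0 <= z <= 1 by rewrite z0.
rewrite subr_ge0 lerBlDr; apply/andP; split.
  rewrite -lee_fin -IS -pgfE//; apply: ge0_le_integral => //.
  - by move=> w _; rewrite lee_fin.
  - exact/measurable_EFinP.
  - exact/measurable_EFinP.
  - by move=> w _; rewrite lee_fin SE; case: ifP => // _; rewrite exprn_ge0.
rewrite -lee_fin EFinD -IS -pgfE//.
have -> : ((z ^+ m)%:E = \int[P]_w (z ^+ m)%:E)%E.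
  by rewrite integral_prob_cst.
rewrite -ge0_integralD//; last 3 first.
- by move=> w _; rewrite lee_fin exprn_ge0.
- by move=> w _; rewrite lee_fin.
- exact/measurable_EFinP.
apply: ge0_le_integral => //.
- by move=> w _; rewrite lee_fin exprn_ge0.
- exact/measurable_EFinP.
- by apply/measurable_EFinP; exact: measurable_funD.
- move=> w _; rewrite -EFinD lee_fin SE; case: ltnP => [_|mN'].
    by rewrite lerDr exprn_ge0.
  by rewrite addr0 ler_wiXn2l.
Qed.

End pgf.

Lemma cvg_sumr (R : realType) (U : Type) (F : set_system U) (FF : Filter F)
    (I : Type) (r : seq I) (f : I -> U -> R) (l : I -> R) :
  (forall i, f i t @[t --> F] --> l i) ->
  \sum_(i <- r) f i t @[t --> F] --> \sum_(i <- r) l i.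
Proof. by move=> fl; apply: cvg_big => // ; exact: add_continuous. Qed.

(* A count with values in {0, 1, 2, ...} u {+oo}, given as the increasing limit
   of finite counts. *)
Section counting_limit.
Context d (T : measurableType d) (R : realType) (P : probability T R).
Variables (q : nat -> T -> nat) (Q : T -> \bar R).
Hypotheses (mq : forall n, measurable_fun setT (q n))
  (ndq : forall w m n, (m <= n)%N -> (q m w <= q n w)%N)
  (qQ : forall w, (q n w)%:R%:E @[n --> \oo] --> Q w).

(** An increasing sequence of naturals is eventually constant or unbounded. *)
Lemma count_limitP w :
  (exists k : nat, Q w = k%:R%:E /\ \forall n \near \oo, q n w = k) \/
  (Q w = +oo%E /\ forall k : nat, \forall n \near \oo, (k < q n w)%N).
Proof.
have [[M qM]|unb] := pselect (exists M, forall n, (q n w <= M)%N).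
  left; pose p k := `[< exists n, q n w = k >].
  have p0 : exists k, p k by exists (q 0%N w); apply/asboolP; exists 0%N.
  have pM k : p k -> (k <= M)%N by move=> /asboolP[n <-].
  case: (ex_maxnP p0 pM) => k /asboolP[N qN] kmax; exists k.
  have qk : \forall n \near \oo, q n w = k.
    exists N => // n /= Nn; apply/eqP; rewrite eqn_leq -{2}qN.
    by rewrite (ndq w Nn) kmax//; apply/asboolP; exists n.
  split=> //; rewrite -(cvg_lim _ (@qQ w))//; apply: cvg_lim => //.
  by apply: cvg_near_cst; apply: filterS qk => n ->.
right.
have big k : \forall n \near \oo, (k < q n w)%N.
  have [[n kn]|nk] := pselect (exists n, k < q n w)%N.
    by exists n => // m /= /(ndq w); exact: leq_trans.
  exfalso; apply: unb; exists k => n; rewrite leqNgt; apply/negP => kn.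
  by apply: nk; exists n.
split=> //; rewrite -(cvg_lim _ (@qQ w))//; apply: cvg_lim => //.
apply/cvgeryP/cvgryPge => A.
near=> n; rewrite (@le_trans _ _ (Num.truncn `|A|).+1%:R)//.
  by rewrite (le_trans (ler_norm _))// ltW// truncnS_gt.
by rewrite ler_nat; near: n; apply: filterS (big _) => n; exact: ltnW.
Unshelve. all: by end_near. Qed.

Lemma count_limit_range w : Q w = +oo%E \/ exists n : nat, Q w = n%:R%:E.
Proof. by have [[k [? _]]|[? _]] := count_limitP w; [right; exists k|left]. Qed.

Lemma measurable_count_limit : measurable_fun setT Q.
Proof.
apply: (emeasurable_fun_cvg (fun n w => (q n w)%:R%:E)) => // n.
apply/measurable_EFinP.
by apply: (measurableT_comp (f := fun k : nat => k%:R : R)).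
Qed.

Lemma measurable_count_limit_atom (k : nat) :
  measurable (Q @^-1` [set k%:R%:E]).
Proof.
by rewrite -[X in measurable X]setTI; exact: measurable_count_limit.
Qed.

(** The indicators of {q n = k} converge pointwise, because q n is eventually
    equal to k or eventually different from k. *)
Lemma cvg_count_pmf (k : nat) :
  fine (P (q n @^-1` [set k])) @[n --> \oo] --> nat_pmf P Q k.
Proof.
have mA n : measurable (q n @^-1` [set k]).
  by rewrite -[X in measurable X]setTI; exact: mq.
have mB := measurable_count_limit_atom k.
suff : P (q n @^-1` [set k]) @[n --> \oo] --> P (Q @^-1` [set k%:R%:E]).
  move=> h; apply: fine_cvg; rewrite fineK//; exact: fin_num_measure.
have intE A : measurable A -> P A = (\int[P]_w (\1_A w)%:E)%E.
  by move=> mA'; rewrite integral_indic// setIT.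
rewrite intE//; under eq_fun do rewrite intE//.
apply: (@dominated_cvg _ _ _ _ _ _ _ _ (cst 1%E)) => //.
- by move=> n; exact/measurable_EFinP/measurable_indic.
- move=> w _; apply: cvg_near_cst.
  have [[l [Ql ql]]|[Qoo big]] := count_limitP w.
    apply: filterS ql => n ql; congr (_ %:E).
    rewrite !indicE; congr (nat_of_bool _)%:R.
    apply/idP/idP; rewrite !inE/= ql Ql; first by move=> ->.
    by move=> [] /eqP; rewrite eqr_nat => /eqP.
  apply: filterS (big k) => n kn; congr (_ %:E).
  rewrite !indicE !memNset//= ?Qoo// => qk.
  by move: kn; rewrite qk ltnn.
- exact: finite_measure_integrable_cst.
- move=> n w _; rewrite /= lee_fin indicE.
  by case: (_ \in _); rewrite ?normr1 ?normr0.
Qed.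

(** The limit g plays the role of E z ^ Q, with z ^ +oo = 0: it satisfies the
    same estimates as the generating function of a finite count. *)
Lemma count_limit_pgf (z g : R) (m : nat) : 0 <= z <= 1 ->
  pgf P (q n) z @[n --> \oo] --> g ->
  0 <= g - \sum_(k < m) nat_pmf P Q k * z ^+ k <= z ^+ m.
Proof.
move=> z01 qg.
have h : pgf P (q n) z -
    \sum_(k < m) fine (P (q n @^-1` [set nat_of_ord k])) * z ^+ k
    @[n --> \oo] --> g - \sum_(k < m) nat_pmf P Q k * z ^+ k.
  apply: cvgB => //; apply: cvg_sumr => k.
  by apply: cvgMr_tmp; exact: cvg_count_pmf.
have cvgh : cvgn (fun n => pgf P (q n) z -
  \sum_(k < m) fine (P (q n @^-1` [set nat_of_ord k])) * z ^+ k).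
  by apply/cvg_ex; eexists; exact: h.
rewrite -(cvg_lim _ h)//; apply/andP; split.
  apply: limr_ge => //; near=> n.
  by have /andP[] := pgf_partial_sum P m (mq n) z01.
apply: limr_le => //; near=> n.
by have /andP[] := pgf_partial_sum P m (mq n) z01.
Unshelve. all: by end_near. Qed.

End counting_limit.

Section pgf_continuity.
Context (R : realType) (U : Type) (F : set_system U) {FF : ProperFilter F}.
Variables (p : U -> nat -> R) (G : U -> R -> R) (p' : nat -> R) (G' : R -> R).
Hypotheses
  (pG : forall t (z : R) m, 0 < z < 1 ->
    0 <= G t z - \sum_(k < m) p t k * z ^+ k <= z ^+ m)
  (pG' : forall (z : R) m, 0 < z < 1 ->
    0 <= G' z - \sum_(k < m) p' k * z ^+ k <= z ^+ m)
  (GG' : forall z : R, 0 < z < 1 -> G t z @[t --> F] --> G' z).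

(** By induction on k, the terms of index less than k cancel in the limit;
    what remains, divided by z ^ k, is p t k - p' k up to an error of at most z,
    and z is arbitrarily small. *)
Lemma pgf_continuity k : p t k @[t --> F] --> p' k.
Proof.
elim/ltn_ind: k => k ih; apply/cvgrPdist_lt => e e0.
(* z <= e / 2 controls the tail after k; the cap 1 / 2 keeps z below 1. *)
pose z := Num.min (e / 2) (1 / 2).
have z0 : 0 < z by rewrite lt_min !divr_gt0.
have z1 : z < 1 by rewrite gt_min orbC ltr_pdivrMr// mul1r ltr1n.
have z01 : 0 < z < 1 by rewrite z0.
have ze : z <= e / 2 by rewrite ge_min lexx.
have D0 : (G' z - \sum_(i < k) p' i * z ^+ i) -
    (G t z - \sum_(i < k) p t i * z ^+ i) @[t --> F] --> 0.
  rewrite -[X in _ --> X](subrr (G' z - \sum_(i < k) p' i * z ^+ i)).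
  apply: cvgB; first exact: cvg_cst.
  apply: cvgB; first exact: GG'.
  by apply: cvg_sumr => i; apply: cvgMr_tmp; exact: ih.
have zk : 0 < z ^+ k by rewrite exprn_gt0.
have e2 : 0 < e / 2 * z ^+ k by rewrite mulr_gt0// divr_gt0.
move/cvgrPdist_lt : D0 => /(_ _ e2); apply: filterS => t.
rewrite sub0r normrN => Dt.
have /andP[] := pG t k.+1 z01; have /andP[] := pG' k.+1 z01.
rewrite !big_ord_recr/= => a1 a2 b1 b2.
rewrite -(ltr_pM2r zk) -[X in _ * X](gtr0_norm zk) -normrM mulrBl.
set A := G' z - _ in Dt; set B := G t z - _ in Dt.
have : `|A - B - (p' k * z ^+ k - p t k * z ^+ k)| <= z * z ^+ k.
  rewrite -exprS ler_norml; apply/andP; split.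
    rewrite -subr_ge0 in b2 *; rewrite /A /B.
    lra.
  by rewrite /A /B; lra.
move=> ABx; rewrite -[X in `|X|](subKr (A - B)).
rewrite (le_lt_trans (ler_normB _ _))//.
have zze : z * z ^+ k <= e / 2 * z ^+ k by rewrite ler_pM2r.
rewrite [e in ltRHS]splitr mulrDl ltr_leD//; exact: le_trans zze.
Qed.
End pgf_continuity.

(** * Integration against exponential laws *)

Section density.
Context d (T : measurableType d) (R : realType)
  (mu m : {measure set T -> \bar R}) (p : T -> R).
Hypotheses (mp : measurable_fun setT p) (p0 : forall x, 0 <= p x)
  (mE : forall A, measurable A -> m A = (\int[mu]_(x in A) (p x)%:E)%E).

Import HBNNSimple.

Let integral_density_indic (A : set T) : measurable A ->
  (\int[m]_x (\1_A x)%:E = \int[mu]_x ((\1_A x)%:E * (p x)%:E))%E.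
Proof.
move=> mA; rewrite integral_indic// setIT mE// integral_mkcond.
apply: eq_integral => x _; rewrite patchE indicE.
by case: ifP => _; rewrite ?mul1e ?mul0e.
Qed.

Let integral_density_nnsfun (f : {nnsfun T >-> R}) :
  (\int[m]_x (f x)%:E = \int[mu]_x ((f x)%:E * (p x)%:E))%E.
Proof.
under [LHS]eq_integral do rewrite fimfunE -fsumEFin//.
rewrite [LHS]ge0_integral_fsum//; last 2 first.
  - by move=> r; exact/measurable_EFinP/measurableT_comp.
  - by move=> r x _; rewrite EFinM nnfun_muleindic_ge0.
under [RHS]eq_integral.
  move=> x _; rewrite fimfunE -fsumEFin// muleC ge0_mule_fsumr; last first.
    by move=> r; rewrite EFinM nnfun_muleindic_ge0.
  over.
rewrite [RHS]ge0_integral_fsum//; last 2 first.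
  - move=> r; apply/measurable_EFinP; apply: measurable_funM => //.
    exact/measurableT_comp.
  - by move=> r x _; rewrite mule_ge0 ?lee_fin// -lee_fin EFinM
      nnfun_muleindic_ge0.
apply: eq_fsbigr => r /[!inE] -[y _ fy].
have r0 : 0 <= r by rewrite -fy.
under eq_integral do rewrite EFinM.
rewrite ge0_integralZl//; last first.
  exact/measurable_EFinP/measurable_indic.
under [RHS]eq_integral do rewrite EFinM muleCA.
rewrite [RHS]ge0_integralZl//; last 2 first.
  - by apply/measurable_EFinP; exact: measurable_funM.
  - by move=> x _; rewrite mule_ge0 ?lee_fin.
rewrite integral_density_indic//; congr (_ * _)%E.
by apply: eq_integral => x _; rewrite muleC.
Qed.

Lemma ge0_integral_density (f : T -> \bar R) : measurable_fun setT f ->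
  (forall x, 0 <= f x)%E -> (\int[m]_x f x = \int[mu]_x (f x * (p x)%:E))%E.
Proof.
move=> mf f0; pose g := nnsfun_approx measurableT mf.
have gf x : (g n x)%:E @[n --> \oo] --> f x by exact: cvg_nnsfun_approx.
have ndg x : {homo (fun n => g n x) : a b / (a <= b)%N >-> a <= b}.
  by move=> a b ab; exact/lefP/nd_nnsfun_approx.
transitivity (limn (fun n => \int[m]_x (g n x)%:E))%E.
  rewrite -monotone_convergence//.
  - by apply: eq_integral => x _; apply/esym/cvg_lim.
  - by move=> n; exact/measurable_EFinP.
  - by move=> n x _; rewrite lee_fin.
  - by move=> x _ a b ab; rewrite lee_fin ndg.
under eq_fun do rewrite integral_density_nnsfun.
rewrite -monotone_convergence//.
- apply: eq_integral => x _; apply/cvg_lim => //.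
  by apply: cvgeZr.
- move=> n; under eq_fun do rewrite -EFinM.
  by apply/measurable_EFinP; exact: measurable_funM.
- by move=> n x _; rewrite mule_ge0 ?lee_fin.
- by move=> x _ a b ab; rewrite lee_wpmul2r ?lee_fin// ndg.
Qed.

End density.

Section exponential_law.
Context (R : realType) (r : R) (r0 : 0 < r) d (T : measurableType d)
  (P : probability T R) (X : {RV P >-> R}).
Notation mu := (@lebesgue_measure R).
Hypothesis X_law : has_law X (exponential_prob r).

(** The variable X is seen as taking values in the measurable space on which
    the Lebesgue measure is defined. *)
Lemma ge0_integral_exponential (f : R -> \bar R) : measurable_fun setT f ->
  (forall x, 0 <= f x)%E ->
  (\int[P]_w f (X w) = \int[mu]_x (f x * (exponential_pdf r x)%:E))%E.
Proof.
move=> mf f0; pose X' (w : T) : measurableTypeR R := X w.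
have mX' : measurable_fun setT X'.
  by have : measurable_fun setT (X : T -> R) by exact: measurable_funPT.
pose mX := isMeasurableFun.Build _ _ _ _ X' mX'.
pose m : {mfun T >-> measurableTypeR R} := HB.pack X' mX.
rewrite -(@ge0_integral_density _ _ R mu (distribution P m)
  (exponential_pdf r))//.
- by rewrite ge0_integral_distribution.
- exact: measurable_exponential_pdf.
- by move=> x; rewrite exponential_pdf_ge0// ltW.
Qed.

Lemma integral_exponential_pdf_gt (u : R) : 0 <= u ->
  (\int[mu]_(x in `]u, +oo[) (exponential_pdf r x)%:E = (expR (- r * u))%:E)%E.
Proof.
move=> u0; rewrite integral_itv_obnd_cbnd; last first.
  by apply/measurable_EFinP/measurable_funTS; exact: measurable_exponential_pdf.
have der (x : R) :
    is_derive x (1 : R) (fun x => - expR (- r * x)) (r * expR (- r * x)).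
  apply: is_derive_eq; rewrite /GRing.scale/=; ring.
have co (x : R) : {for x, continuous (fun x => - expR (- r * x))}.
  by apply/differentiable_continuous/derivable1_diffP; case: (der x).
rewrite (@ge0_continuous_FTC2y _ _ (fun x => - expR (- r * x)) _ 0)//.
- by rewrite sub0e EFinN oppeK.
- by move=> x _; rewrite exponential_pdf_ge0// ltW.
- apply: (@continuous_subspaceW R^o _ _ [set` `[0, +oo[%R]); last first.
    exact: within_continuous_exponential_pdf.
  by move=> x /=; rewrite !in_itv/= !andbT; exact: le_trans.
- rewrite -oppr0; apply: cvgN.
  have -> : (fun x => expR (- r * x)) = (fun z => expR (- z)) \o ( *%R r).
    by apply: eq_fun => x; rewrite mulNr.
  apply: (@cvg_comp _ _ _ _ _ _ (pinfty_nbhs R)); last exact: cvgr_expR.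
  exact: gt0_cvgMry.
- by apply: cvg_at_right_filter; exact: co.
- move=> x; rewrite in_itv/= andbT => ux; rewrite derive1E derive_val.
  by rewrite exponential_pdfE// ltW// (le_lt_trans u0).
Qed.

Lemma exponential_gt (u : R) : 0 <= u ->
  P (X @^-1` `]u, +oo[) = (expR (- r * u))%:E.
Proof.
by move=> u0; rewrite -integral_exponential_pdf_gt//; exact: X_law.
Qed.

(** The tilted density exp(- x) r exp(- r x) is r / (r + 1) times the density of
    rate r + 1. *)
Lemma exponential_laplace1 :
  (\int[P]_w (expR (- X w))%:E = (r / (r + 1))%:E)%E.
Proof.
have r1 : 0 < r + 1 by rewrite addr_gt0.
rewrite (ge0_integral_exponential (f := fun x => (expR (- x))%:E));
  last 2 first.
- apply/measurable_EFinP; apply: (measurableT_comp (f := expR)) => //.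
- by move=> x; rewrite lee_fin expR_ge0.
rewrite -[RHS]mule1 -(integral_exponential_pdf r1) -ge0_integralZl//;
  last 3 first.
- by apply/measurable_EFinP; exact: measurable_exponential_pdf.
- by move=> x _; rewrite lee_fin exponential_pdf_ge0// ltW.
- by rewrite lee_fin divr_ge0// ltW.
apply: eq_integral => x _; rewrite -!EFinM; congr EFin.
have [x0|x0] := ltP x 0; first by rewrite !lt0_exponential_pdf ?mulr0.
rewrite !exponential_pdfE//.
have -> : - (r + 1) * x = - x + - r * x by ring.
rewrite expRD; field; exact: lt0r_neq0.
Qed.

(** For functions of the age t - A of an arrival at A: an arrival still to come
    contributes the factor 1. *)
Definition extend_by1 (g : R -> R) (v : R) : R := if 0 <= v then g v else 1.

(** Conditioning on the first arrival X. The differential equation says that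
    s |-> - exp(- r s) H (u - s) is a primitive of
    r exp(- r s) h(u - s) H(u - s), so [0, u] contributes H u - exp(- r u), and
    the event X > u contributes the missing exp(- r u). *)
Lemma exponential_renewal (h H : R -> R) (u : R) :
  measurable_fun setT (extend_by1 h) -> measurable_fun setT (extend_by1 H) ->
  (forall v : R, 0 <= v -> 0 <= h v) -> (forall v : R, 0 <= v -> 0 <= H v) ->
  H 0 = 1 ->
  (forall v : R, 0 <= v -> {for v, continuous h}) ->
  (forall v : R, 0 <= v -> is_derive v (1 : R) H (- r * (1 - h v) * H v)) ->
  (\int[P]_w (extend_by1 h (u - X w) * extend_by1 H (u - X w))%:E =
   (extend_by1 H u)%:E)%E.
Proof.
move=> mh mH h0 H0 H01 ch dH.
have eh0 v : 0 <= extend_by1 h v by rewrite /extend_by1; case: ifPn => // /h0.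
have eH0 v : 0 <= extend_by1 H v by rewrite /extend_by1; case: ifPn => // /H0.
have mu_ : measurable_fun setT (fun s : R => u - s) by exact: measurable_funB.
have mg : measurable_fun setT
    (fun s : R => extend_by1 h (u - s) * extend_by1 H (u - s)).
  by apply: measurable_funM;
    [exact: (measurableT_comp mh)|exact: (measurableT_comp mH)].
rewrite (ge0_integral_exponential (f := fun s =>
  (extend_by1 h (u - s) * extend_by1 H (u - s))%:E)); last 2 first.
- exact/measurable_EFinP.
- by move=> x; rewrite lee_fin mulr_ge0.
have [u0|u0] := ltP u 0.
  rewrite [in RHS]/extend_by1 leNgt u0/= -(integral_exponential_pdf r0).
  apply: eq_integral => s _.
  have [s0|s0] := ltP s 0; first by rewrite lt0_exponential_pdf// mule0.
  by rewrite /extend_by1 subr_ge0 leNgt (lt_le_trans u0 s0)/= mul1r mul1e.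
pose f s := ((extend_by1 h (u - s) * extend_by1 H (u - s))%:E *
  (exponential_pdf r s)%:E)%E.
have mf : measurable_fun setT f.
  rewrite /f; under eq_fun do rewrite -EFinM.
  apply/measurable_EFinP; apply: measurable_funM => //.
  exact: measurable_exponential_pdf.
have f0 s : (0 <= f s)%E.
  by rewrite /f -EFinM lee_fin !mulr_ge0// exponential_pdf_ge0// ltW.
rewrite -[LHS]/(\int[mu]_s f s)%E.
have -> : (\int[mu]_s f s = \int[mu]_(s in `[0%R, +oo[) f s)%E.
  rewrite [RHS]integral_mkcond; apply: eq_integral => s _; rewrite patchE.
  case: ifPn => //; rewrite notin_setE/= in_itv/= andbT => /negP.
  by rewrite -ltNge => s0; rewrite /f lt0_exponential_pdf// mule0.
have -> : `[0%R, +oo[%classic = `[0%R, u] `|` `]u, +oo[ :> set R.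
  by rewrite -itv_bndbnd_setU// bnd_simp.
rewrite ge0_integral_setU//; last 2 first.
- exact: measurable_funTS.
- apply/disj_set2P/seteqP; split=> // s /=.
  by rewrite !in_itv/= andbT => -[/andP[_ su]]; rewrite ltNge su.
have -> : (\int[mu]_(x in `]u, +oo[) f x = (expR (- r * u))%:E)%E.
  rewrite -integral_exponential_pdf_gt//; apply: eq_integral => s.
  rewrite inE/= in_itv/= andbT => us.
  by rewrite /f /extend_by1 subr_ge0 leNgt us/= mul1r mul1e.
suff -> : (\int[mu]_(x in `[0%R, u]) f x = (H u - expR (- r * u))%:E)%E.
  by rewrite -EFinD subrK /extend_by1 u0.
move: u0; rewrite le_eqVlt => /predU1P[<-|u0].
  by rewrite set_itv1 integral_set1 H01 mulr0 expR0 subrr.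
(* The primitive, and its derivative by the equation satisfied by H. *)
pose F s := - expR (- r * s) * H (u - s).
pose g s := h (u - s) * H (u - s) * (r * expR (- r * s)).
have dF (s : R) : s <= u -> is_derive s (1 : R) F (g s).
  move=> su; have us : 0 <= u - s by rewrite subr_ge0.
  have dHs := dH _ us.
  have dHc : is_derive s (1 : R) (H \o (fun s => u - s))
      (- (- r * (1 - h (u - s)) * H (u - s))).
    apply: (is_derive_eq (is_derive1_comp _ _)).
    ring.
  rewrite /F /g; apply: is_derive_eq; rewrite /GRing.scale/=; ring.
transitivity (\int[mu]_(s in `[0%R, u]) (g s)%:E)%E.
  apply: eq_integral => s; rewrite inE/= in_itv/= => /andP[s0 su].
  by rewrite /f /extend_by1 subr_ge0 su exponential_pdfE// /g -EFinM.
have cF s : s <= u -> {for s, continuous F}.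
  move=> su; apply/differentiable_continuous/derivable1_diffP.
  by case: (dF s su).
rewrite (@continuous_FTC2 _ _ F)//.
- by rewrite /F subrr H01 subr0 !mulr0 expR0 mulr1 mulN1r -EFinB opprK addrC.
- apply: continuous_in_subspaceT => s /[!inE]/= /[!in_itv]/= /andP[_ su].
  have us : 0 <= u - s by rewrite subr_ge0.
  have cs : {for s, continuous (fun x => u - x)}.
    by apply: cvgB; [exact: cvg_cst|exact: cvg_id].
  apply: cvgM; last first.
    apply: cvgM; first exact: cvg_cst.
    apply: (continuous_comp (g := expR)); last exact: continuous_expR.
    by apply: cvgM; [exact: cvg_cst|exact: cvg_id].
  apply: cvgM; first exact: (continuous_comp cs (ch _ us)).
  apply: (continuous_comp cs).
  by apply/differentiable_continuous/derivable1_diffP; case: (dH _ us).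
- split.
  + by move=> s; rewrite in_itv/= => /andP[_ /ltW/dF[]].
  + by apply: cvg_at_right_filter; exact/cF/ltW.
  + by apply: cvg_at_left_filter; exact: cF.
- move=> s; rewrite in_itv/= => /andP[_ /ltW/dF ds].
  by rewrite derive1E derive_val.
Qed.
End exponential_law.

(** * The series of the tails of the batch size *)

Section batch_series.
Context (R : realType) (b : nat -> R).
Hypotheses (b_ge0 : forall j, 0 <= b j) (b_le1 : forall j, b j <= 1)
  (b0 : b 0 = 1).

Let c (j : nat) : R := b j / j%:R.

(** For b = 1 this is - ln (1 - x). The term j = 0 is b 0 / 0 = 0. *)
Definition log_series (x : R) : R := limn (pseries c x).

Let c_ge0 j : 0 <= c j. Proof. by rewrite divr_ge0. Qed.

Let c_le1 j : c j <= 1.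
Proof.
rewrite /c; case: j => [|j]; first by rewrite invr0 mulr0.
by rewrite ler_pdivrMr// mul1r (le_trans (b_le1 _))// ler1n.
Qed.

Let cS j : j.+1%:R * c j.+1 = b j.+1.
Proof. by rewrite /c mulrC divfK// pnatr_eq0. Qed.

(** The partial sums increase and have a closed form bounded by 1 / (1 - K)^2.
    This dominates the series of L and of its first two derivatives. *)
Lemma is_cvg_arithmetic_geometric (K : R) : 0 <= K < 1 ->
  cvgn (series (fun i => i.+1%:R * K ^+ i)).
Proof.
move=> /andP[K0 K1]; have K1' : 0 < 1 - K by rewrite subr_gt0.
have E n : series (fun i => i.+1%:R * K ^+ i) n * (1 - K) ^+ 2 =
    1 - K ^+ n * (1 + n%:R * (1 - K)).
  rewrite /series/=; elim: n => [|n ih].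
    by rewrite big_geq// expr0 !mul0r addr0 mulr1 subrr.
  by rewrite big_nat_recr//= mulrDl ih [K ^+ n.+1]exprS -[n.+1%:R]natr1; ring.
apply: nondecreasing_is_cvgn.
  by apply: nondecreasing_series => n _ _; rewrite mulr_ge0 ?exprn_ge0.
exists ((1 - K) ^+ 2)^-1 => _ [n _ <-].
rewrite -(ler_pM2r (x := (1 - K) ^+ 2)) ?exprn_gt0// E mulVf; last first.
  by rewrite lt0r_neq0// exprn_gt0.
by rewrite gerBl mulr_ge0 ?exprn_ge0// addr_ge0// mulr_ge0// ltW.
Qed.

Let is_cvg_pseries_le (a : nat -> R) (K : R) : 0 <= K < 1 ->
  (forall i, 0 <= a i <= i.+1%:R) -> cvgn (pseries a K).
Proof.
move=> K01 a01; have /andP[K0 _] := K01.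
apply: (series_le_cvg _ _ _ (is_cvg_arithmetic_geometric K01)) => n.
- by have /andP[? _] := a01 n; rewrite mulr_ge0 ?exprn_ge0.
- by rewrite mulr_ge0 ?exprn_ge0.
- by have /andP[_ ?] := a01 n; rewrite ler_wpM2r ?exprn_ge0.
Qed.

Lemma is_cvg_log_series (x : R) : 0 <= x < 1 -> cvgn (pseries c x).
Proof.
move=> x01; apply: is_cvg_pseries_le => // i; rewrite c_ge0/=.
by rewrite (le_trans (c_le1 _))// ler1n.
Qed.

Lemma log_series_homo (x y : R) : 0 <= x -> x <= y -> y < 1 ->
  log_series x <= log_series y.
Proof.
move=> x0 xy y1; have y0 := le_trans x0 xy; have x1 := le_lt_trans xy y1.
apply: lim_series_le => [||j].
- by apply: is_cvg_log_series; rewrite x0.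
- by apply: is_cvg_log_series; rewrite y0.
- by rewrite ler_wpM2l// lerXn2r ?nnegrE.
Qed.

Let diffs1 : pseries_diffs c = fun i => b i.+1.
Proof. by apply/funext => i; rewrite /pseries_diffs cS. Qed.

(** Termwise differentiation inside the unit disc: j b_j / j = b_j. *)
Lemma is_derive_log_series (x : R) : 0 <= x < 1 ->
  is_derive x (1 : R) log_series (limn (pseries (fun i => b i.+1) x)).
Proof.
move=> /andP[x0 x1]; rewrite -diffs1.
pose K := (1 + x) / 2.
have K01 : 0 <= K < 1 by rewrite /K; lra.
apply: (@pseries_snd_diffs _ _ K).
- exact: is_cvg_log_series.
- rewrite diffs1; apply: is_cvg_pseries_le => // i.
  by rewrite b_ge0 (le_trans (b_le1 _))// ler1n.
- rewrite diffs1; apply: is_cvg_pseries_le => // i; rewrite /pseries_diffs.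
  by rewrite mulr_ge0//= ger_pMr.
- by rewrite !ger0_norm /K; lra.
Qed.

Variable h : R -> R.
Hypothesis bh : forall (x : R) m, 0 <= x <= 1 ->
  0 <= h x - \sum_(k < m) (b k - b k.+1) * x ^+ k <= x ^+ m.

(** Summation by parts, b k - b k.+1 being the point masses of the batch size
    and h its generating function. *)
Lemma tail_series (x : R) : 0 <= x < 1 ->
  (1 - x) * limn (pseries (fun i => b i.+1) x) = 1 - h x.
Proof.
move=> x01; have /andP[x0 x1] := x01.
have x01' : 0 <= x <= 1 by rewrite x0 ltW.
have cvb : cvgn (pseries (fun i => b i.+1) x).
  apply: is_cvg_pseries_le => // i.
  by rewrite b_ge0 (le_trans (b_le1 _))// ler1n.
have E n : (1 - x) * pseries (fun i => b i.+1) x n =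
    1 - \sum_(k < n) (b k - b k.+1) * x ^+ k - b n * x ^+ n.
  rewrite /pseries /series/= big_mkord; elim: n => [|n ih].
    by rewrite !big_ord0 b0 expr0; ring.
  by rewrite !big_ord_recr/= mulrDr ih exprS; ring.
have xn : x ^+ n @[n --> \oo] --> 0 by apply: cvg_expr; rewrite ger0_norm.
have bxn : b n * x ^+ n @[n --> \oo] --> 0.
  apply: (squeeze_cvgr _ (cvg_cst 0) xn); near=> n.
  by rewrite mulr_ge0 ?exprn_ge0//= ler_piMl ?exprn_ge0.
have hn : h x - \sum_(k < n) (b k - b k.+1) * x ^+ k @[n --> \oo] --> 0.
  apply: (squeeze_cvgr _ (cvg_cst 0) xn); near=> n; exact: bh.
have lhs : (1 - x) * pseries (fun i => b i.+1) x n @[n --> \oo] -->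
    (1 - x) * limn (pseries (fun i => b i.+1) x) by exact: cvgMl_tmp.
rewrite -(cvg_lim _ lhs)//; apply: cvg_lim => //.
rewrite -[X in _ --> X]subr0 -[X in _ --> X - _]addr0.
under eq_fun => n.
  rewrite E (_ : _ - _ - _ = (1 - h x +
    (h x - \sum_(k < n) (b k - b k.+1) * x ^+ k)) - b n * x ^+ n); last by ring.
  over.
by apply: cvgB => //; apply: cvgD => //; exact: cvg_cst.
Unshelve. all: by end_near. Qed.

Lemma derive_log_series (x : R) : 0 <= x < 1 ->
  is_derive x (1 : R) log_series ((1 - h x) / (1 - x)).
Proof.
move=> x01; rewrite -tail_series// mulrC mulKf; last first.
  by rewrite subr_eq0 gt_eqF//; case/andP: x01.
exact: is_derive_log_series.
Qed.

(** The polynomials of the estimate bh converge to h uniformly on [0, K], for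
    K < 1. *)
Lemma continuous_pgf (x : R) : 0 < x < 1 -> {for x, continuous h}.
Proof.
move=> /andP[x0 x1]; apply/cvgrPdist_lt => e e0.
pose K := (1 + x) / 2.
have K0 : 0 <= K by rewrite /K; lra.
have K1 : K < 1 by rewrite /K; lra.
have xK : x < K by rewrite /K; lra.
have [m Km] : exists m, K ^+ m < e / 2.
  have : K ^+ n @[n --> \oo] --> 0 by apply: cvg_expr; rewrite ger0_norm.
  have e2 : 0 < e / 2 by rewrite divr_gt0.
  move=> /cvgrPdist_lt/(_ _ e2)[m _ /(_ m (leqnn m))]/=.
  by rewrite sub0r normrN ger0_norm ?exprn_ge0// => ?; exists m.
pose p y := \sum_(k < m) (b k - b k.+1) * y ^+ k.
have cp : p y @[y --> x] --> p x.
  apply: cvg_big => [|i _]; first exact: add_continuous.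
  by apply: cvgMl_tmp; exact: exprn_continuous.
have e2 : 0 < e / 2 by rewrite divr_gt0.
move/cvgrPdist_lt : cp => /(_ _ e2) cp.
near=> y.
have y0 : 0 < y by near: y; exact: lt_nbhsr.
have yK : y < K by near: y; exact: lt_nbhsl.
have pxy : `|p x - p y| < e / 2 by near: y.
have x01 : 0 <= x <= 1 by rewrite !ltW.
have y01 : 0 <= y <= 1 by rewrite !ltW// (lt_trans yK).
have /andP[a1 a2] := @bh x m x01; have /andP[b1 b2] := @bh y m y01.
rewrite -/(p x) in a1 a2; rewrite -/(p y) in b1 b2.
have xm : x ^+ m <= K ^+ m by rewrite lerXn2r ?nnegrE// ltW.
have ym : y ^+ m <= K ^+ m by rewrite lerXn2r ?nnegrE// ltW.
move: pxy; rewrite !ltr_norml => /andP[]; lra.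
Unshelve. all: by end_near. Qed.

(** Abel's theorem in multiplicative form, which allows the series at 1 to
    diverge: then g = 0. The partial sums S J y give the upper bound on the
    exponential for each J, and their limits at y = 1 the lower bound g. *)
Lemma log_series_abel (rho z g : R) (U : Type) (F : set_system U)
    {FF : ProperFilter F} (x : U -> R) :
  0 <= rho -> 0 <= z < 1 -> x t @[t --> F] --> (1 : R) ->
  (\forall t \near F, z <= x t < 1) ->
  expR (- rho * \sum_(j < J) b j / j%:R * (1 - z ^+ j)) @[J --> \oo] --> g ->
  expR (- rho * (log_series (x t) - log_series z)) @[t --> F] --> g.
Proof.
move=> rho0 z01 x1 zx1 Eg; have /andP[z0 z1] := z01.
pose S J y := \sum_(j < J) c j * (y ^+ j - z ^+ j).
have leE (u v : R) : u <= v -> expR (- rho * v) <= expR (- rho * u).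
  by move=> uv; rewrite ler_expR !mulNr lerN2 ler_wpM2l.
have Slim y : z <= y < 1 -> S J y @[J --> \oo] --> log_series y - log_series z.
  move=> /andP[zy y1]; have y0 := le_trans z0 zy.
  have -> : S ^~ y = pseries c y \- pseries c z.
    apply/funext => J; rewrite /S /pseries /series/= !big_mkord -sumrB.
    by apply: eq_bigr => j _; rewrite mulrBr.
  by apply: cvgB; apply: is_cvg_log_series; rewrite ?y0 ?z0.
have ndS y : z <= y -> nondecreasing_seq (S ^~ y).
  move=> zy; apply/nondecreasing_seqP => J; rewrite /S big_ord_recr/= lerDl.
  by rewrite mulr_ge0// subr_ge0 lerXn2r ?nnegrE// (le_trans z0).
have Sle y J : z <= y < 1 -> S J y <= log_series y - log_series z.
  move=> zy; have Sy := Slim _ zy; rewrite -(cvg_lim _ Sy)//.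
  apply: nondecreasing_cvgn_le; last by apply/cvg_ex; eexists; exact: Sy.
  by apply: ndS; case/andP: zy.
have SleS y J : z <= y < 1 -> S J y <= \sum_(j < J) c j * (1 - z ^+ j).
  move=> /andP[zy y1]; apply: ler_sum => j _; apply: ler_wpM2l => //.
  by rewrite lerD2r exprn_ile1 ?(le_trans z0)// ltW.
have gle y : z <= y < 1 -> g <= expR (- rho * (log_series y - log_series z)).
  move=> zy.
  have Sy : expR (- rho * S J y) @[J --> \oo] -->
      expR (- rho * (log_series y - log_series z)).
    apply: continuous_cvg; first exact: continuous_expR.
    by apply: cvgMl_tmp; exact: Slim.
  by apply: (ler_cvg_to Eg Sy); near=> J; apply: leE; exact: SleS.
apply/cvgrPdist_lt => e e0; have e2 : 0 < e / 2 by rewrite divr_gt0.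
have [J EJ] : exists J,
    expR (- rho * \sum_(j < J) c j * (1 - z ^+ j)) < g + e / 2.
  move/cvgrPdist_lt : Eg => /(_ _ e2)[J _ /(_ J (leqnn J))]/=.
  by rewrite distrC => /ltr_distlDr; exists J.
have SJ : expR (- rho * S J (x t)) @[t --> F] -->
    expR (- rho * \sum_(j < J) c j * (1 - z ^+ j)).
  apply: continuous_cvg; first exact: continuous_expR.
  apply: cvgMl_tmp; apply: cvg_big => [|j _]; first exact: add_continuous.
  apply: cvgMl_tmp; apply: cvgB; last exact: cvg_cst.
  have -> : 1 = 1 ^+ j :> R by rewrite expr1n.
  exact: (cvg_comp _ _ x1 (@exprn_continuous _ j 1)).
move/cvgrPdist_lt : SJ => /(_ _ e2) SJ.
near=> t.
have zx : z <= x t < 1 by near: t.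
rewrite distrC ger0_norm ?subr_ge0 ?gle// ltrBlDl.
rewrite (le_lt_trans (leE _ _ (Sle _ J zx)))//.
have : `|expR (- rho * \sum_(j < J) c j * (1 - z ^+ j)) -
  expR (- rho * S J (x t))| < e / 2 by near: t.
by rewrite distrC => /ltr_distlDr; move: EJ; lra.
Unshelve. all: by end_near. Qed.

End batch_series.

(** * The generating function of the number in system *)

Lemma measurable_extend_by1 (R : realType) (g : R -> R) :
  (forall v : R, 0 <= v -> {for v, continuous g}) ->
  measurable_fun setT (extend_by1 g).
Proof.
move=> cg; apply: measurable_fun_if => //.
- exact: measurable_fun_ler.
- rewrite setTI.
  have -> : (fun x : R => 0 <= x) @^-1` [set true] = `[0, +oo[%classic.
    by apply/seteqP; split=> x /=; rewrite in_itv/= andbT.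
  apply: subspace_continuous_measurable_fun => //.
  apply: continuous_in_subspaceT => v /[!inE]/= /[!in_itv]/= /[!andbT].
  exact: cg.
Qed.

Section queue.
Context (R : realType) (lambda mu : R) (lambda_gt0 : 0 < lambda)
  (mu_gt0 : 0 < mu) (d : measure_display) (T : measurableType d)
  (P : probability T R) (tau : nat -> {RV P >-> R}) (N : nat -> {RV P >-> nat})
  (S : nat -> nat -> {RV P >-> R}) (queue : MNMinfty_queue tau N S lambda mu).
Variables (z t : R).
Hypothesis z01 : 0 < z < 1.

Let F := queue_sigma tau N S.

Let indepF : mutual_independence P setT F.
Proof. exact: primitives_independent queue. Qed.

Let FT i : F i setT.
Proof. by case: i => [[i|i]|[i k]]; exact: g_sigma_algebra_preimage_setT. Qed.

Let FI i : setI_closed (F i).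
Proof.
by case: i => [[i|i]|[i k]]; exact: setI_closed_g_sigma_algebra_preimage.
Qed.

Let Fm i : F i `<=` measurable.
Proof.
case: i => [[i|i]|[i k]]; apply: g_sigma_algebra_preimage_measurable.
- by have : measurable_fun setT (tau i : T -> R) by exact: measurable_funPT.
- by have : measurable_fun setT (N i : T -> nat) by exact: measurable_funPT.
- by have : measurable_fun setT (S i k : T -> R) by exact: measurable_funPT.
Qed.

Let others (i : nat + nat + nat * nat) := othersType setT F i.

Let m_tau j i : i != inl (inl j) -> measurable_fun setT (tau j : others i -> R).
Proof. by rewrite eq_sym => ji; exact: (measurable_fun_others _ ji). Qed.

Let m_N j i : i != inl (inr j) -> measurable_fun setT (N j : others i -> nat).
Proof. by rewrite eq_sym => ji; exact: (measurable_fun_others _ ji). Qed.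

Let m_S j k i : i != inr (j, k) -> measurable_fun setT (S j k : others i -> R).
Proof. by rewrite eq_sym => ji; exact: (measurable_fun_others _ ji). Qed.

(** The contribution to z ^ Q_t of a customer with service time s who arrived at
    time t - u. *)
Definition presence_factor (u s : R) : R :=
  if (0 <= u) && (u < s) then z else 1.

Lemma presence_factor_ge0 u s : 0 <= presence_factor u s.
Proof.
by rewrite /presence_factor; case: ifP => // _; case/andP: z01 => /ltW.
Qed.

Lemma presence_factor_le1 u s : presence_factor u s <= 1.
Proof.
by rewrite /presence_factor; case: ifP => // _; case/andP: z01 => _ /ltW.
Qed.

Lemma measurable_presence_factor d0 (T0 : measurableType d0) (U V : T0 -> R) :
  measurable_fun setT U -> measurable_fun setT V ->
  measurable_fun setT (fun w => presence_factor (U w) (V w)).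
Proof.
move=> mU mV; apply: measurable_fun_ifT => //.
by apply: measurable_and; [exact: measurable_fun_ler|exact: measurable_fun_ltr].
Qed.

(** Its expectation over the service time, for u >= 0. *)
Definition customer_pgf (u : R) : R := 1 - (1 - z) * expR (- mu * u).
Let x := customer_pgf.

Lemma integral_presence_factor i k (u : R) :
  (\int[P]_v (presence_factor u (S i k v))%:E = (extend_by1 x u)%:E)%E.
Proof.
have /andP[z0 z1] := z01.
rewrite /extend_by1; case: ifPn => u0; last first.
  rewrite -(integral_prob_cst P 1); apply: eq_integral => v _.
  by rewrite /presence_factor (negbTE u0).
pose A := S i k @^-1` `]u, +oo[.
have mA : measurable A.
  by rewrite -[X in measurable X]setTI; exact: measurable_funPT.
have PA : P A = (expR (- mu * u))%:E.
  exact: (exponential_gt mu_gt0 (service_law queue i k)).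
have inA v : (v \in A) = (u < S i k v).
  by apply/idP/idP; rewrite inE /A/= in_itv/= andbT.
under eq_integral => v _.
  rewrite (_ : presence_factor _ _ = z + (1 - z) * \1_(~` A) v); last first.
    by rewrite /presence_factor u0/= indicE in_setC inA;
      case: ifP => _; rewrite /=; ring.
  rewrite EFinD EFinM; over.
have mCA : measurable (~` A) by exact: measurableC.
rewrite ge0_integralD//; last 3 first.
- by move=> v _; rewrite lee_fin ltW.
- by move=> v _; rewrite -EFinM lee_fin mulr_ge0// subr_ge0 ltW.
- by apply/measurable_EFinP; apply: measurable_funM.
rewrite integral_prob_cst ge0_integralZl//; last 2 first.
- exact/measurable_EFinP/measurable_indic.
- by rewrite lee_fin subr_ge0 ltW.
have -> : (\int[P]_v (\1_(~` A) v)%:E = (1 - expR (- mu * u))%:E)%E.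
  by rewrite integral_indic//= setIT probability_setC// PA.
rewrite -EFinM -EFinD.
by rewrite /x /customer_pgf; congr EFin; ring.
Qed.

Let psi := extend_by1 x.

Lemma customer_pgf_itv u : 0 <= u -> z <= x u < 1.
Proof.
move=> u0; have /andP[z0 z1] := z01.
have e0 : 0 < expR (- mu * u) by exact: expR_gt0.
have e1 : expR (- mu * u) <= 1.
  by rewrite -expR0 ler_expR mulNr oppr_le0 mulr_ge0// ltW.
rewrite /x /customer_pgf; apply/andP; split; last first.
  by rewrite ltrBlDr ltrDl mulr_gt0// subr_gt0.
have : (1 - z) * expR (- mu * u) <= 1 - z by rewrite ger_pMr// subr_gt0.
lra.
Qed.

Let psi_ge0 u : 0 <= psi u.
Proof.
rewrite /psi /extend_by1; case: ifPn => // /customer_pgf_itv/andP[zx _].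
by rewrite (le_trans _ zx)// ltW//; case/andP: z01.
Qed.

Let psi_le1 u : psi u <= 1.
Proof.
rewrite /psi /extend_by1; case: ifPn => // /customer_pgf_itv/andP[_].
exact: ltW.
Qed.

Let continuous_x (u : R) : {for u, continuous x}.
Proof.
apply: cvgB; first exact: cvg_cst.
apply: cvgMl_tmp; apply: (continuous_comp (g := expR)) => //.
  by apply: cvgMl_tmp; exact: cvg_id.
exact: continuous_expR.
Qed.

Let measurable_psi : measurable_fun setT psi.
Proof. by apply: measurable_extend_by1 => v _; exact: continuous_x. Qed.

(** Given the number n and the arrival time of the customers of a batch, their
    services are integrated out one by one. *)
Lemma peel_services i n (W U : T -> R) :
  (forall k, measurable_fun setT (W : others (inr (i, k)) -> R)) ->
  (forall k, measurable_fun setT (U : others (inr (i, k)) -> R)) ->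
  (forall w, 0 <= W w) ->
  (\int[P]_w (W w * \prod_(k < n) presence_factor (U w) (S i k w))%:E =
   \int[P]_w (W w * psi (U w) ^+ n)%:E)%E.
Proof.
elim: n W => [|n ih] W mW mU W0.
  by apply: eq_integral => w _; rewrite big_ord0 expr0.
pose g s w := (W w * \prod_(k < n) presence_factor (U w) (S i k w) *
  presence_factor (U w) s)%:E.
transitivity (\int[P]_w g (S i n w) w)%E.
  by apply: eq_integral => w _; rewrite /g big_ord_recr/= mulrA.
rewrite (peel_inner indepF FT FI Fm (i := inr (i, n))) //; last 2 first.
- apply/measurable_EFinP; apply: measurable_funM; last first.
    apply: measurable_presence_factor => //.
    exact: (measurableT_comp (mU n)).
  apply: measurable_funM; first exact: (measurableT_comp (mW n)).
  apply: measurable_prod => k _; apply: measurable_presence_factor.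
    exact: (measurableT_comp (mU n)).
  apply: (measurableT_comp (f := (S i k : others (inr (i, n)) -> R))) => //.
  by apply: m_S; apply/eqP => -[nk]; have := ltn_ord k; rewrite -nk ltnn.
- move=> s w; rewrite lee_fin mulr_ge0 ?presence_factor_ge0// mulr_ge0//.
  rewrite prodr_ge0// => k _.
  exact: presence_factor_ge0.
transitivity (\int[P]_w (W w * psi (U w) *
  \prod_(k < n) presence_factor (U w) (S i k w))%:E)%E.
  apply: eq_integral => w _; rewrite /g.
  under eq_integral do rewrite EFinM.
  rewrite ge0_integralZl//; last 3 first.
  - by apply/measurable_EFinP; apply: measurable_presence_factor.
  - by move=> v _; rewrite lee_fin presence_factor_ge0.
  - rewrite lee_fin mulr_ge0// prodr_ge0// => k _.
    exact: presence_factor_ge0.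
  by rewrite integral_presence_factor -EFinM mulrAC.
rewrite ih.
- by apply: eq_integral => w _; rewrite exprS mulrA.
- move=> k; apply: measurable_funM => //.
  exact: (measurableT_comp measurable_psi).
- exact: mU.
- by move=> w; rewrite mulr_ge0.
Qed.

Let h := pgf P (N 0).

Let pgf_N i y : 0 <= y <= 1 -> (\int[P]_v (y ^+ N i v)%:E = (h y)%:E)%E.
Proof.
move=> y01; have /andP[y0 _] := y01.
rewrite -(pgfE P _ y01); last exact: measurable_funPT.
transitivity (\int[distribution P (N i)]_n (y ^+ n)%:E)%E.
  by rewrite ge0_integral_distribution// => n; rewrite lee_fin exprn_ge0.
rewrite (eq_measure_integral (distribution P (N 0))); last first.
  by move=> A mA _; exact: (batch_size_law queue).
by rewrite ge0_integral_distribution// => n; rewrite lee_fin exprn_ge0.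
Qed.

(** The batch size is integrated out after the services of the batch, although
    it determines how many of them are involved: the expectation is first
    written as an average over the values n of the batch size, where
    [peel_services] applies, and then recombined. *)
Lemma peel_batch i (W U : T -> R) :
  (forall k, measurable_fun setT (W : others (inr (i, k)) -> R)) ->
  (forall k, measurable_fun setT (U : others (inr (i, k)) -> R)) ->
  measurable_fun setT (W : others (inl (inr i)) -> R) ->
  measurable_fun setT (U : others (inl (inr i)) -> R) ->
  (forall w, 0 <= W w) ->
  (\int[P]_w (W w * \prod_(k < N i w) presence_factor (U w) (S i k w))%:E =
   \int[P]_w (W w * h (psi (U w)))%:E)%E.
Proof.
move=> mW mU mWN mUN W0.
pose g n w := (W w * \prod_(k < n) presence_factor (U w) (S i k w))%:E.
pose g' n w := (W w * psi (U w) ^+ n)%:E.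
have prod_ge0 n w : 0 <= \prod_(k < n) presence_factor (U w) (S i k w).
  by apply: prodr_ge0 => k _; exact: presence_factor_ge0.
have g_ge0 n w : (0 <= g n w)%E by rewrite lee_fin mulr_ge0.
have g'_ge0 n w : (0 <= g' n w)%E by rewrite lee_fin mulr_ge0 ?exprn_ge0.
have mg : measurable_fun setT
    (fun p : nat * others (inl (inr i)) => g p.1 p.2).
  apply: measurable_fun_nat_pair => n; apply/measurable_EFinP.
  apply: measurable_funM => //; apply: measurable_prod => k _.
  by apply: measurable_presence_factor => //; exact: m_S.
have mg' : measurable_fun setT
    (fun p : nat * others (inl (inr i)) => g' p.1 p.2).
  apply: measurable_fun_nat_pair => n; apply/measurable_EFinP.
  apply: measurable_funM => //; apply: measurable_funX.
  exact: (measurableT_comp measurable_psi).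
rewrite (peel_outer indepF FT FI Fm _ _ mg)//.
under eq_integral do rewrite (peel_services _ mW mU W0).
rewrite -(peel_outer indepF FT FI Fm _ (X := N i) _ mg')//.
rewrite (peel_inner indepF FT FI Fm _ _ mg')//.
apply: eq_integral => w _; rewrite /g'; under eq_integral do rewrite EFinM.
rewrite ge0_integralZl//.
- by rewrite pgf_N ?psi_ge0 ?psi_le1// -EFinM.
- apply/measurable_EFinP/measurable_exprn_nat.
  exact: measurable_funPT.
- by move=> v _; rewrite lee_fin exprn_ge0.
- by rewrite lee_fin.
Qed.

Let b := batch_tail N.

Let measurable_batch_ge j : measurable [set w | (j <= N 0 w)%N].
Proof.
have mN : measurable_fun setT (N 0 : T -> nat) by exact: measurable_funPT.
by rewrite -[X in measurable X]setTI; exact: (mN _ [set n | (j <= n)%N]).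
Qed.

Let b_ge0 j : 0 <= b j. Proof. exact: fine_ge0. Qed.

Let b_le1 j : b j <= 1.
Proof. by rewrite -lee_fin fineK ?probability_le1// fin_num_measure. Qed.

Let b0 : b 0 = 1.
Proof.
rewrite /b /batch_tail (_ : [set _ | _] = setT) ?probability_setT//.
by apply/seteqP; split.
Qed.

Lemma batch_size_pmf k : fine (P (N 0 @^-1` [set k])) = b k - b k.+1.
Proof.
apply/eqP; rewrite eq_sym subr_eq; apply/eqP.
have mk : measurable (N 0 @^-1` [set k]).
  by rewrite -[X in measurable X]setTI; exact: measurable_funPT.
rewrite /b /batch_tail -fineD ?fin_num_measure// -measureU//.
  congr (fine (P _)); apply/seteqP; split=> w /=.
    by rewrite leq_eqVlt => /orP[/eqP ->|]; [left|right].
  by move=> [->//|/ltnW].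
by apply/seteqP; split=> // w [/= ->]; rewrite ltnn.
Qed.

Let h_partial_sum y m : 0 <= y <= 1 ->
  0 <= h y - \sum_(k < m) (b k - b k.+1) * y ^+ k <= y ^+ m.
Proof.
move=> y01; under eq_bigr do rewrite -batch_size_pmf.
by apply: pgf_partial_sum => //; exact: measurable_funPT.
Qed.

Let h_ge0 y : 0 <= y <= 1 -> 0 <= h y.
Proof. by move=> /(h_partial_sum 0)/andP[]; rewrite big_ord0 subr0. Qed.

Let h1 : h 1 = 1.
Proof.
rewrite /h /pgf; under eq_integral do rewrite expr1n.
by rewrite integral_prob_cst.
Qed.

(** The generating function of the number in system at time u >= 0, that is,
    exp (- lambda int_0^u (1 - h(x(v))) dv) in closed form. *)
Definition queue_pgf_nonneg (u : R) : R :=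
  expR (- (lambda / mu) * (log_series b (x u) - log_series b z)).
Let H := queue_pgf_nonneg.

Let x_itv0 u : 0 <= u -> 0 <= x u < 1.
Proof.
move=> /customer_pgf_itv/andP[zx ->]; rewrite andbT (le_trans _ zx)// ltW//.
by case/andP: z01.
Qed.

Let x_itv01 u : 0 <= u -> 0 <= x u <= 1.
Proof. by move=> /x_itv0/andP[-> /ltW]. Qed.

(* The derivatives mu (1 - x) of x and (1 - h) / (1 - x) of L combine so that
   the factor 1 - x cancels. *)
Let is_derive_H (v : R) : 0 <= v ->
  is_derive v (1 : R) H (- lambda * (1 - h (x v)) * H v).
Proof.
move=> v0; have xv := x_itv0 v0; have /andP[_ xv1] := xv.
have dL := derive_log_series b_ge0 b_le1 b0 h_partial_sum xv.
have dx : is_derive v (1 : R) x (mu * (1 - x v)).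
  rewrite /x /customer_pgf; apply: is_derive_eq.
  by rewrite /GRing.scale/=; ring.
have dLx : is_derive v (1 : R) (log_series b \o x) (mu * (1 - h (x v))).
  apply: is_derive_eq; rewrite /GRing.scale/=.
  have x1 : 1 - x v != 0 by rewrite subr_eq0 gt_eqF.
  by field.
rewrite /H /queue_pgf_nonneg.
have -> : (fun u =>
    expR (- (lambda / mu) * (log_series b (x u) - log_series b z))) =
  expR \o (fun u =>
    - (lambda / mu) * ((log_series b \o x) u - log_series b z)) by [].
apply: is_derive_eq; rewrite /GRing.scale/=.
have mu0 : mu != 0 by rewrite gt_eqF.
by field.
Qed.

Let continuous_H (v : R) : 0 <= v -> {for v, continuous H}.
Proof.
by move=> v0; apply/differentiable_continuous/derivable1_diffP;
  case: (is_derive_H v0).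
Qed.

Let continuous_hx (v : R) : 0 <= v -> {for v, continuous (h \o x)}.
Proof.
move=> v0; have /andP[zx x1] := customer_pgf_itv v0.
apply: continuous_comp; first exact: continuous_x.
apply: (continuous_pgf h_partial_sum); rewrite x1 andbT (lt_le_trans _ zx)//.
by case/andP: z01.
Qed.

Let H0 : H 0 = 1.
Proof.
rewrite /H /queue_pgf_nonneg /x /customer_pgf mulr0 expR0 mulr1 subKr.
rewrite subrr mulr0.
exact: expR0.
Qed.

Let h_psi u : h (psi u) = extend_by1 (h \o x) u.
Proof. by rewrite /psi /extend_by1; case: ifP. Qed.

Definition queue_pgf := extend_by1 H.

Lemma measurable_queue_pgf : measurable_fun setT queue_pgf.
Proof. exact: measurable_extend_by1. Qed.

Lemma queue_pgf_gt0 u : 0 < queue_pgf u.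
Proof.
by rewrite /queue_pgf /extend_by1; case: ifP => // _; exact: expR_gt0.
Qed.

(** A is the arrival epoch preceding the interarrival time tau i. *)
Lemma peel_arrival i (W A : T -> R) :
  measurable_fun setT (W : others (inl (inl i)) -> R) ->
  measurable_fun setT (A : others (inl (inl i)) -> R) ->
  (forall w, 0 <= W w) ->
  (\int[P]_w (W w * (h (psi (t - (A w + tau i w))) *
                     queue_pgf (t - (A w + tau i w))))%:E =
   \int[P]_w (W w * queue_pgf (t - A w))%:E)%E.
Proof.
move=> mW mA W0.
pose g s w := (W w * (h (psi (t - (A w + s))) * queue_pgf (t - (A w + s))))%:E.
have hpsi0 u : 0 <= h (psi u) by rewrite h_ge0// psi_ge0 psi_le1.
have mhpsi : measurable_fun setT (h \o psi).
  by rewrite (_ : _ \o _ = extend_by1 (h \o x)); [exact: measurable_extend_by1|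
    apply/funext => u; exact: h_psi].
rewrite (peel_inner indepF FT FI Fm (i := inl (inl i)) (X := tau i) _ _
  (g := g))//; last 2 first.
- apply/measurable_EFinP; apply: measurable_funM.
    exact: (measurableT_comp mW).
  have mU : measurable_fun setT
      (fun p : R * others (inl (inl i)) => t - (A p.2 + p.1)).
    apply: measurable_funB => //; apply: measurable_funD => //.
    exact: (measurableT_comp mA).
  apply: measurable_funM; first exact: (measurableT_comp mhpsi).
  exact: (measurableT_comp measurable_queue_pgf).
- by move=> s w; rewrite lee_fin !mulr_ge0// ltW// queue_pgf_gt0.
apply: eq_integral => w _; rewrite /g; under eq_integral do rewrite EFinM.
rewrite ge0_integralZl//; last 3 first.
- apply/measurable_EFinP.
  have mU : measurable_fun setT (fun v => t - (A w + tau i v)).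
    by apply: measurable_funB => //; apply: measurable_funD.
  apply: measurable_funM; first exact: (measurableT_comp mhpsi).
  exact: (measurableT_comp measurable_queue_pgf).
- by move=> v _; rewrite lee_fin mulr_ge0// ltW// queue_pgf_gt0.
- by rewrite lee_fin.
under eq_integral do rewrite opprD addrA h_psi.
rewrite [X in (_ * X)%E](exponential_renewal (h := h \o x) (H := H)
  lambda_gt0 (interarrival_law queue i)).
- by rewrite -EFinM.
- exact: measurable_extend_by1.
- exact: measurable_queue_pgf.
- by move=> v v0; exact/h_ge0/x_itv01.
- by move=> v v0; exact: expR_ge0.
- exact: H0.
- exact: continuous_hx.
- exact: is_derive_H.
Qed.

(** The n-th arrival epoch counted from 1, so that epoch 0 = 0; it is
    [arrival_epoch n.-1] for n > 0. *)
Definition epoch (n : nat) (w : T) : R := \sum_(k < n) tau k w.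

Definition batch_factor (i : nat) (w : T) : R :=
  \prod_(k < N i w) presence_factor (t - epoch i.+1 w) (S i k w).

Definition first_batches_factor (n : nat) (w : T) : R :=
  \prod_(i < n) batch_factor i w.
Let W := first_batches_factor.

Let W_ge0 n w : 0 <= W n w.
Proof.
by apply: prodr_ge0 => i _; apply: prodr_ge0 => k _; exact: presence_factor_ge0.
Qed.

Let W_le1 n w : W n w <= 1.
Proof.
apply: prodr_ile1 => i _; rewrite prodr_ge0/=; last first.
  by move=> k _; exact: presence_factor_ge0.
by apply: prodr_ile1 => k _; rewrite presence_factor_ge0 presence_factor_le1.
Qed.

Lemma measurable_epoch (G : set_system T) n :
  (forall i, (i < n)%N ->
    measurable_fun setT (tau i : g_sigma_algebraType G -> R)) ->
  measurable_fun setT (epoch n : g_sigma_algebraType G -> R).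
Proof. by move=> mt; apply: measurable_sum => i; exact: mt. Qed.

Lemma measurable_first_batches_factor (G : set_system T) n :
  (forall i, (i < n)%N ->
    [/\ measurable_fun setT (tau i : g_sigma_algebraType G -> R),
        measurable_fun setT (N i : g_sigma_algebraType G -> nat) &
        forall k, measurable_fun setT (S i k : g_sigma_algebraType G -> R)]) ->
  measurable_fun setT (W n : g_sigma_algebraType G -> R).
Proof.
move=> mv; apply: measurable_prod => i _.
have [_ mN mS] := mv _ (ltn_ord i).
apply: (measurable_fun_nat_comp (T := g_sigma_algebraType G) (f := fun n w =>
  \prod_(k < n) presence_factor (t - epoch i.+1 w) (S i k w)) mN) => m.
apply: measurable_prod => k _; apply: measurable_presence_factor => //.
apply: measurable_funB => //; apply: measurable_epoch => j ji.
by have [] := mv j (leq_trans ji (ltn_ord i)).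
Qed.

(** The product of the factors of the first n batches, times the generating
    function of what arrives later: the last batch is integrated out. *)
Lemma queue_pgf_martingale n :
  (\int[P]_w (W n w * queue_pgf (t - epoch n w))%:E = (queue_pgf t)%:E)%E.
Proof.
elim: n => [|n ih].
  rewrite -(integral_prob_cst P); apply: eq_integral => w _.
  by rewrite /W /first_batches_factor /epoch !big_ord0 mul1r subr0.
have mW_ (j : nat + nat + nat * nat) :
    (forall i, (i < n)%N -> [/\ j != inl (inl i), j != inl (inr i) &
       forall k, j != inr (i, k)]) ->
    measurable_fun setT (W n : others j -> R).
  move=> jn; apply: measurable_first_batches_factor => i /jn[j1 j2 j3].
  by split; [exact: m_tau|exact: m_N|move=> k; exact: m_S].
have mepoch_ m (j : nat + nat + nat * nat) :
    (forall i, (i < m)%N -> j != inl (inl i)) ->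
    measurable_fun setT (epoch m : others j -> R).
  by move=> jm; apply: measurable_epoch => i /jm; exact: m_tau.
pose U w := t - epoch n.+1 w.
pose V w := W n w * queue_pgf (U w).
have V0 w : 0 <= V w by rewrite mulr_ge0// ltW// queue_pgf_gt0.
have mU j : (forall i, (i < n.+1)%N -> j != inl (inl i)) ->
    measurable_fun setT (U : others j -> R).
  by move=> jn; apply: measurable_funB => //; exact: mepoch_.
transitivity (\int[P]_w
  (V w * \prod_(k < N n w) presence_factor (U w) (S n k w))%:E)%E.
  apply: eq_integral => w _.
  by rewrite /W /first_batches_factor big_ord_recr/= /V mulrAC.
have mV j : (forall i, (i < n)%N -> [/\ j != inl (inl i), j != inl (inr i) &
    forall k, j != inr (i, k)]) -> j != inl (inl n) ->
    measurable_fun setT (V : others j -> R).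
  move=> jn jn'; apply: measurable_funM; first exact: mW_.
  apply: (measurableT_comp measurable_queue_pgf); apply: mU => i.
  by rewrite ltnS leq_eqVlt => /orP[/eqP -> //|/jn[]].
rewrite peel_batch//.
- rewrite -ih -(peel_arrival (i := n))//.
  + by apply: eq_integral => w _; rewrite /V /U /epoch big_ord_recr/= -mulrA
      [queue_pgf _ * _]mulrC.
  + apply: mW_ => i ni; split=> //.
    by apply/eqP => -[] // ni'; rewrite ni' ltnn in ni.
  + by apply: mepoch_ => i ni; apply/eqP => -[] ni'; rewrite ni' ltnn in ni.
- move=> k; apply: mV => // i ni; split=> // k'.
  by apply/eqP => -[ni' _]; rewrite ni' ltnn in ni.
- by move=> k; apply: mU.
- apply: mV => // i ni; split=> //.
  by apply/eqP => -[ni']; rewrite ni' ltnn in ni.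
- exact: mU.
Qed.

(** Used for P (epoch n <= t) <= exp t E exp (- epoch n), which tends to 0. *)
Lemma laplace_epoch n :
  (\int[P]_w (expR (- epoch n w))%:E = ((lambda / (lambda + 1)) ^+ n)%:E)%E.
Proof.
elim: n => [|n ih].
  rewrite expr0 -(integral_prob_cst P); apply: eq_integral => w _.
  by rewrite /epoch big_ord0 oppr0 expR0.
have mexpN d0 (T0 : measurableType d0) (f : T0 -> R) : measurable_fun setT f ->
    measurable_fun setT (fun w => expR (- f w)).
  by move=> mf; do 2 apply: measurableT_comp => //.
pose g s w := (expR (- epoch n w) * expR (- s))%:E.
transitivity (\int[P]_w g (tau n w) w)%E.
  by apply: eq_integral => w _; rewrite /g /epoch big_ord_recr/= opprD expRD.
rewrite (peel_inner indepF FT FI Fm (i := inl (inl n)))//; last 2 first.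
- apply/measurable_EFinP; apply: measurable_funM; last exact: mexpN.
  apply: (measurableT_comp (f := fun w : others (inl (inl n)) =>
    expR (- epoch n w))) => //.
  apply: mexpN; apply: measurable_epoch => i ni; apply: m_tau.
  by apply/eqP => -[ni']; rewrite ni' ltnn in ni.
- by move=> s w; rewrite lee_fin mulr_ge0 ?expR_ge0.
have mtau : measurable_fun setT (fun v => expR (- tau n v)) by exact: mexpN.
rewrite exprS EFinM -ih -ge0_integralZl//.
- apply: eq_integral => w _; rewrite /g.
  under eq_integral do rewrite EFinM.
  rewrite ge0_integralZl//.
    by rewrite (exponential_laplace1 lambda_gt0 (interarrival_law queue n))
      muleC.
  exact/measurable_EFinP.
- by apply/measurable_EFinP; apply: mexpN; apply: measurable_sum.
- by rewrite lee_fin divr_ge0// ltW// addr_gt0.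
Qed.

Definition count_present (n : nat) (w : T) : nat :=
  \sum_(i < n) \sum_(k < N i w) present tau S t i k w.

Lemma exprn_count_present n w : z ^+ count_present n w = W n w.
Proof.
rewrite /count_present expr_sum; apply: eq_bigr => i _.
rewrite expr_sum; apply: eq_bigr => k _.
rewrite /presence_factor /present subr_ge0 ltrBlDl.
rewrite -[epoch _ _]/(arrival_epoch tau i w).
by case: ifP => _; rewrite ?expr1 ?expr0.
Qed.

Lemma measurable_count_present n : measurable_fun setT (count_present n).
Proof.
apply: (@measurable_sum_nat _ _ n
  (fun i w => \sum_(k < N i w) present tau S t i k w)%N) => i _.
apply: (measurable_fun_nat_comp (f := fun m w =>
  (\sum_(k < m) present tau S t i k w)%N)) => // m.
apply: (@measurable_sum_nat _ _ m
  (fun k w => nat_of_bool (present tau S t i k w))) => k _.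
apply: (measurableT_comp (f := nat_of_bool)) => //.
have marr : measurable_fun setT (arrival_epoch tau i) by exact: measurable_sum.
apply: measurable_and; first exact: measurable_fun_ler.
by apply: measurable_fun_ltr => //; apply: measurable_funD.
Qed.

Lemma count_present_homo w m n : (m <= n)%N ->
  (count_present m w <= count_present n w)%N.
Proof.
move=> mn; rewrite /count_present.
rewrite -(big_mkord xpredT (fun i => \sum_(k < N i w) present tau S t i k w)%N).
rewrite -(big_mkord xpredT (fun i => \sum_(k < N i w) present tau S t i k w)%N).
by rewrite [leqRHS](@big_cat_nat _ _ _ m)//= leq_addr.
Qed.

Lemma cvg_count_present w :
  (count_present n w)%:R%:E @[n --> \oo] --> number_in_system tau N S t w.
Proof.
rewrite /number_in_system.
have -> : (fun n => ((count_present n w)%:R : R)%:E) = (fun n =>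
    \sum_(0 <= i < n) (\sum_(k < N i w | present tau S t i k w) 1%R)%:E)%E.
  apply/funext => n; rewrite sumEFin /count_present natr_sum big_mkord.
  congr EFin; apply: eq_bigr => i _; rewrite natr_sum [RHS]big_mkcond.
  by apply: eq_bigr => k _; case: ifP.
apply: is_cvg_nneseries => i _ _; rewrite lee_fin; exact: sumr_ge0.
Qed.

(** The martingale factor differs from 1 only if epoch n <= t. *)
Lemma pgf_count_present_bounds n :
  queue_pgf t <= pgf P (count_present n) z <=
  queue_pgf t + expR t * (lambda / (lambda + 1)) ^+ n.
Proof.
have /andP[z0 z1] := z01.
have z01' : 0 <= z <= 1 by rewrite !ltW.
have mW : measurable_fun setT (W n).
  have -> : W n = fun w => z ^+ count_present n w.
    by apply/funext => w; rewrite exprn_count_present.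
  exact/measurable_exprn_nat/measurable_count_present.
have mep : measurable_fun setT (epoch n) by exact: measurable_sum.
have mid : measurable_fun setT (fun w => queue_pgf (t - epoch n w)).
  apply: (measurableT_comp measurable_queue_pgf); exact: measurable_funB.
have mWi : measurable_fun setT (fun w => W n w * queue_pgf (t - epoch n w)).
  exact: measurable_funM.
have me : measurable_fun setT (fun w => expR t * expR (- epoch n w)).
  apply: measurable_funM => //; do 2 apply: measurableT_comp => //.
have pgfW : (\int[P]_w (W n w)%:E = (pgf P (count_present n) z)%:E)%E.
  rewrite -pgfE//; last exact: measurable_count_present.
  by apply: eq_integral => w _; rewrite exprn_count_present.
have queue_pgf_le1 u : queue_pgf u <= 1.
  rewrite /queue_pgf /extend_by1; case: ifPn => // u0.
  rewrite /H /queue_pgf_nonneg -expR0 ler_expR mulNr oppr_le0 mulr_ge0//.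
    by rewrite divr_ge0// ltW.
  have /andP[zx x1] := customer_pgf_itv u0.
  by rewrite subr_ge0; apply: log_series_homo => //; rewrite ltW.
apply/andP; split.
  rewrite -lee_fin -pgfW -(queue_pgf_martingale n).
  apply: ge0_le_integral => //.
  - by move=> w _; rewrite lee_fin mulr_ge0// ltW// queue_pgf_gt0.
  - exact/measurable_EFinP.
  - exact/measurable_EFinP.
  - by move=> w _; rewrite lee_fin ler_piMr.
rewrite -lee_fin EFinD EFinM -pgfW -(queue_pgf_martingale n) -laplace_epoch.
rewrite -ge0_integralZl//; last first.
  by apply/measurable_EFinP; do 2 apply: measurableT_comp => //.
rewrite -ge0_integralD//; last 3 first.
- by move=> w _; rewrite lee_fin mulr_ge0// ltW// queue_pgf_gt0.
- exact/measurable_EFinP.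
- exact/measurable_EFinP.
apply: ge0_le_integral => //.
- by move=> w _; rewrite lee_fin.
- exact/measurable_EFinP.
- by apply/measurable_EFinP; exact: measurable_funD.
move=> w _; rewrite -EFinM -EFinD lee_fin -expRD.
have [et|et] := leP 0 (t - epoch n w).
  rewrite (le_trans (W_le1 n w))// ler_wpDl//.
    by rewrite mulr_ge0// ltW// queue_pgf_gt0.
  by rewrite -expR0 ler_expR.
by rewrite /queue_pgf /extend_by1 [0 <= _]leNgt et/= mulr1 lerDl expR_ge0.
Qed.

Lemma cvg_pgf_count_present :
  pgf P (count_present n) z @[n --> \oo] --> queue_pgf t.
Proof.
have ub : queue_pgf t + expR t * (lambda / (lambda + 1)) ^+ n
    @[n --> \oo] --> queue_pgf t.
  rewrite -[X in _ --> X]addr0; apply: cvgD; first exact: cvg_cst.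
  rewrite -[X in _ --> X](mulr0 (expR t)); apply: cvgMl_tmp.
  apply: cvg_expr; have l1 : 0 < lambda + 1 by rewrite addr_gt0.
  rewrite ger0_norm; last by rewrite divr_ge0// ltW.
  by rewrite ltr_pdivrMr// mul1r ltrDl.
apply: (squeeze_cvgr _ (cvg_cst (queue_pgf t)) ub); near=> n.
exact: pgf_count_present_bounds.
Unshelve. all: by end_near. Qed.

Lemma cvg_customer_pgf : x u @[u --> +oo] --> (1 : R).
Proof.
rewrite -[X in _ --> X]subr0; apply: cvgB; first exact: cvg_cst.
rewrite -[X in _ --> X](mulr0 (1 - z)); apply: cvgMl_tmp.
have -> : (fun u => expR (- mu * u)) = (fun v => expR (- v)) \o ( *%R mu).
  by apply/funext => u; rewrite /= mulNr.
apply: (@cvg_comp _ _ _ _ _ _ (pinfty_nbhs R)); last exact: cvgr_expR.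
exact: gt0_cvgMry.
Qed.

Lemma cvg_queue_pgf (g : R) :
  expR (- (lambda / mu) * \sum_(j < J) b j / j%:R * (1 - z ^+ j))
    @[J --> \oo] --> g ->
  queue_pgf u @[u --> +oo] --> g.
Proof.
move=> Eg; have /andP[z0 z1] := z01.
have Hg : H u @[u --> +oo] --> g.
  apply: (log_series_abel b_ge0 b_le1 _ _ cvg_customer_pgf _ Eg).
  - by rewrite divr_ge0// ltW.
  - by rewrite ltW.
  - by near=> u; exact: customer_pgf_itv.
apply: cvg_trans Hg; apply: near_eq_cvg; near=> u.
rewrite /queue_pgf /extend_by1 ifT//.
Unshelve. all: by end_near. Qed.

End queue.

(** * The weighted sum of Poisson variables *)

Section poisson.
Context d (T : measurableType d) (R : realType) (P : probability T R)
  (Y : {RV P >-> nat}) (r : R).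
Hypotheses (r_ge0 : 0 <= r) (Y_law : has_law Y (Pois r)).

Let mY : measurable_fun setT (Y : T -> nat).
Proof. exact: measurable_funPT. Qed.

(** For r = 0 the right-hand side is the point mass at 0, as 0 ^ 0 = 1. *)
Lemma poisson_atom k :
  fine (P (Y @^-1` [set k])) = r ^+ k / k`!%:R * expR (- r).
Proof.
have -> : P (Y @^-1` [set k]) = Pois r [set k] by exact: Y_law.
rewrite /Pois /poisson_prob; case: ifPn => r0.
  by rewrite esum_set1 ?lee_fin ?poisson_pmf_ge0// /poisson_pmf r0.
have -> : r = 0 by apply/eqP; rewrite eq_le r_ge0 leNgt r0.
rewrite diracE expr0n oppr0 expR0 mulr1; case: k => [|k].
  by rewrite mem_set//= fact0 divr1.
by rewrite memNset//= mul0r.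
Qed.

Lemma poisson_pgf (s : R) : 0 <= s < 1 -> pgf P Y s = expR (- (r * (1 - s))).
Proof.
move=> /andP[s0 s1]; have s01 : 0 <= s <= 1 by rewrite s0 ltW.
have sm : s ^+ m @[m --> \oo] --> 0 by apply: cvg_expr; rewrite ger0_norm.
pose p m := \sum_(k < m) fine (P (Y @^-1` [set nat_of_ord k])) * s ^+ k.
have h0 : pgf P Y s - p m @[m --> \oo] --> 0.
  apply: (squeeze_cvgr _ (cvg_cst 0) sm); near=> m; exact: pgf_partial_sum.
have h1 : p m @[m --> \oo] --> expR (- (r * (1 - s))).
  have -> : expR (- (r * (1 - s))) = expR (- r) * expR (r * s).
    by rewrite -expRD; congr expR; ring.
  have -> : p = (fun m => expR (- r) * series (exp_coeff (r * s)) m).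
    apply/funext => m; rewrite /p /series/= big_mkord mulr_sumr.
    apply: eq_bigr => k _; rewrite poisson_atom /exp_coeff/= exprMn; ring.
  by apply: cvgMl_tmp; exact: is_cvg_series_exp_coeff.
have h2 : pgf P Y s - p m @[m --> \oo] -->
    pgf P Y s - expR (- (r * (1 - s))).
  by apply: cvgB => //; exact: cvg_cst.
apply/eqP; rewrite -subr_eq0 -(cvg_lim _ h2)//; apply/eqP; exact: cvg_lim.
Unshelve. all: by end_near. Qed.

End poisson.

Section weighted_poisson_sum.
Context d (T : measurableType d) (R : realType) (P : probability T R)
  (Y : nat -> {RV P >-> nat}) (r : nat -> R) (z : R).
Hypotheses (r_ge0 : forall j, 0 <= r j) (r0 : r 0 = 0)
  (Y_law : forall j, (0 < j)%N -> has_law (Y j) (Pois (r j)))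
  (Y_indep : mutual_independence P [set j | (0 < j)%N]
     (fun j => g_sigma_algebra_preimage (Y j)))
  (z01 : 0 < z < 1).

(** The term j = 0 vanishes, so these are the partial sums of [weighted_sum]. *)
Definition weighted_count (J : nat) (w : T) : nat := \sum_(j < J) j * Y j w.

Let FT j : g_sigma_algebra_preimage (Y j) setT.
Proof. exact: g_sigma_algebra_preimage_setT. Qed.

Let FI j : setI_closed (g_sigma_algebra_preimage (Y j)).
Proof. exact: setI_closed_g_sigma_algebra_preimage. Qed.

Let Fm j : g_sigma_algebra_preimage (Y j) `<=` measurable.
Proof.
apply: g_sigma_algebra_preimage_measurable.
by have : measurable_fun setT (Y j : T -> nat) by exact: measurable_funPT.
Qed.

Lemma measurable_weighted_count J : measurable_fun setT (weighted_count J).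
Proof.
apply: (@measurable_sum_nat _ _ J (fun j w => j * Y j w)%N) => j _.
by apply: (measurableT_comp (f := muln j)) => //; exact: measurable_funPT.
Qed.

Lemma pgf_weighted_count J :
  pgf P (weighted_count J) z = expR (- \sum_(j < J) r j * (1 - z ^+ j)).
Proof.
have /andP[z0 z1] := z01.
have z01' : 0 <= z <= 1 by rewrite !ltW.
apply: EFin_inj; rewrite -pgfE//; last exact: measurable_weighted_count.
elim: J => [|J ih].
  rewrite big_ord0 oppr0 expR0 -(integral_prob_cst P 1).
  by apply: eq_integral => w _; rewrite /weighted_count big_ord0 expr0.
rewrite big_ord_recr/= opprD expRD EFinM -ih.
have [->|J0] := posnP J.
  rewrite r0 mul0r oppr0 expR0 mule1; apply: eq_integral => w _.
  by rewrite /weighted_count big_ord_recr/= mul0n addn0.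
pose g n w := (z ^+ weighted_count J w * (z ^+ J) ^+ n)%:E.
transitivity (\int[P]_w g (Y J w) w)%E.
  apply: eq_integral => w _.
  by rewrite /g /weighted_count big_ord_recr/= exprD exprM.
rewrite (peel_inner Y_indep FT FI Fm (i := J) J0)//; last 2 first.
- apply: measurable_fun_nat_pair => n; apply/measurable_EFinP.
  apply: measurable_funM => //; apply: measurable_exprn_nat.
  apply: (@measurable_sum_nat _ (othersType _ _ J) J
    (fun j w => j * Y j w)%N) => j jJ.
  have [j0|j0] := posnP j.
    rewrite (_ : (fun w => _) = cst 0%N); first exact: measurable_cst.
    by apply/funext => w; rewrite j0.
  apply: (measurableT_comp (f := muln j)) => //.
  by apply: (measurable_fun_others (j := j)); rewrite ?(ltn_eqF jJ).
- by move=> n w; rewrite lee_fin mulr_ge0// !exprn_ge0// ltW.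
have zJ0 : 0 <= z ^+ J by rewrite exprn_ge0// ltW.
have zJ1 : z ^+ J < 1 by rewrite exprn_ilt1 ?ltW// -lt0n.
rewrite muleC -ge0_integralZl//; last 2 first.
- exact/measurable_EFinP/measurable_exprn_nat/measurable_weighted_count.
- by move=> w _; rewrite lee_fin exprn_ge0// ltW.
apply: eq_integral => w _; rewrite /g; under eq_integral do rewrite EFinM.
rewrite ge0_integralZl//; last 3 first.
- by apply/measurable_EFinP/measurable_exprn_nat; exact: measurable_funPT.
- by move=> v _; rewrite lee_fin exprn_ge0.
- by rewrite lee_fin exprn_ge0// ltW.
rewrite pgfE//; last by rewrite zJ0 ltW.
by rewrite (poisson_pgf (r_ge0 J) (Y_law J0)) ?zJ0// muleC.
Qed.

Lemma weighted_count_homo w m n : (m <= n)%N ->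
  (weighted_count m w <= weighted_count n w)%N.
Proof.
move=> mn; rewrite /weighted_count -!(big_mkord xpredT (fun i => i * Y i w)%N).
by rewrite [leqRHS](@big_cat_nat _ _ _ m)//= leq_addr.
Qed.

Lemma cvg_weighted_count w :
  (weighted_count n w)%:R%:E @[n --> \oo] --> weighted_sum R Y w.
Proof.
rewrite /weighted_sum.
have -> : (fun n => ((weighted_count n w)%:R : R)%:E) = (fun n =>
    \sum_(1 <= j < n) (j * Y j w)%:R%:E)%E.
  apply/funext => -[|n]; rewrite sumEFin /weighted_count natr_sum.
    by rewrite big_ord0 big_geq.
  rewrite -(big_mkord xpredT (fun i => (i * Y i w)%:R)) big_ltn//.
  by rewrite mul0n add0r.
by apply: is_cvg_nneseries => i _ _; rewrite lee_fin.
Qed.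

End weighted_poisson_sum.

(** * Laws on the naturals with a point at infinity *)

Section atoms.
Context d1 d2 (T1 : measurableType d1) (T2 : measurableType d2) (R : realType)
  (P1 : probability T1 R) (P2 : probability T2 R)
  (V1 : T1 -> \bar R) (V2 : T2 -> \bar R).
Hypotheses (mV1 : measurable_fun setT V1) (mV2 : measurable_fun setT V2)
  (V1_range : forall w, V1 w = +oo%E \/ exists n : nat, V1 w = n%:R%:E)
  (V2_range : forall w, V2 w = +oo%E \/ exists n : nat, V2 w = n%:R%:E)
  (V12 : forall n : nat,
    P1 (V1 @^-1` [set n%:R%:E]) = P2 (V2 @^-1` [set n%:R%:E])).

Let probability_finite_part d (T : measurableType d) (P : probability T R)
    (V : T -> \bar R) (A : set (\bar R)) : measurable_fun setT V ->
  (forall w, V w = +oo%E \/ exists n : nat, V w = n%:R%:E) -> ~ A +oo%E ->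
  P (V @^-1` A) = (\sum_(0 <= n <oo)
    if n%:R%:E \in A then P (V @^-1` [set n%:R%:E]) else 0)%E.
Proof.
move=> mV Vr Aoo.
have -> : V @^-1` A =
    \bigcup_n (if n%:R%:E \in A then V @^-1` [set n%:R%:E] else set0).
  apply/seteqP; split=> [w /= VA|w [n _]].
    have [Voo|[n Vn]] := Vr w; first by move: VA; rewrite Voo.
    by exists n => //; rewrite -Vn mem_set.
  by case: ifPn => // /[!inE] nA /= ->.
rewrite measure_bigcup//=.
- apply: congr_lim; apply/funext => m; apply: eq_big => [n|n _].
    by rewrite in_setT.
  by case: ifP; rewrite ?measure0.
- move=> n _; case: ifP => // _; rewrite -[X in measurable X]setTI; exact: mV.
- move=> m n _ _ [w []]; case: ifP => // _ /= Vm; case: ifP => // _ /=.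
  by rewrite Vm => -[/eqP]; rewrite eqr_nat => /eqP.
Qed.

(** Sets that avoid the point at infinity are countable unions of atoms of the
    law; the others are handled through their complements. *)
Lemma eq_law_atoms : eq_law P1 P2 V1 V2.
Proof.
have fin (A : set (\bar R)) : ~ A +oo%E -> P1 (V1 @^-1` A) = P2 (V2 @^-1` A).
  move=> Aoo; rewrite !probability_finite_part//; apply: eq_eseriesr => n _.
  by rewrite V12.
move=> A mA; rewrite /pushforward.
have [Aoo|] := pselect (A +oo%E); last exact: fin.
have mA1 : measurable (V1 @^-1` A).
  by rewrite -[X in measurable X]setTI; exact: mV1.
have mA2 : measurable (V2 @^-1` A).
  by rewrite -[X in measurable X]setTI; exact: mV2.
rewrite -[V1 @^-1` A]setCK -[V2 @^-1` A]setCK.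
rewrite [LHS]probability_setC; last exact: measurableC.
rewrite [RHS]probability_setC; last exact: measurableC.
by congr (1 - _)%E; apply: (fin (~` A)) => /(_ Aoo).
Qed.

End atoms.

(** * The steady state *)

Section steady_state.
Context (R : realType) (lambda mu : R)
    (lambda_gt0 : 0 < lambda) (mu_gt0 : 0 < mu)
    (d : measure_display) (T : measurableType d) (P : probability T R)
    (tau : nat -> {RV P >-> R}) (N : nat -> {RV P >-> nat})
    (S : nat -> nat -> {RV P >-> R})
    (queue : MNMinfty_queue tau N S lambda mu)
    (d' : measure_display) (T' : measurableType d') (P' : probability T' R)
    (Y : nat -> {RV P' >-> nat})
    (Y_law : forall j, (0 < j)%N ->
       has_law (Y j) (Pois (lambda / (j%:R * mu) * batch_tail N j)))
    (Y_indep : mutual_independence P' [set j | (0 < j)%N]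
       (fun j => g_sigma_algebra_preimage (Y j))).

Let Q := number_in_system tau N S.
Let Z := weighted_sum R Y.

Let rate (j : nat) : R := lambda / (j%:R * mu) * batch_tail N j.

Let rate_ge0 j : 0 <= rate j.
Proof.
rewrite /rate mulr_ge0//; last exact: fine_ge0.
by rewrite divr_ge0 ?mulr_ge0// ltW.
Qed.

Let rate0 : rate 0 = 0.
Proof. by rewrite /rate mul0r invr0 mulr0 mul0r. Qed.

(* The exponent of the generating function of sum_j j Y_j, in the form
   reached by that of the queue. *)
Let exponentE (z : R) J : - \sum_(j < J) rate j * (1 - z ^+ j) =
  - (lambda / mu) * \sum_(j < J) batch_tail N j / j%:R * (1 - z ^+ j).
Proof.
rewrite mulNr mulr_sumr; congr (- _); apply: eq_bigr => j _.
by rewrite /rate invfM; ring.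
Qed.

Let pgf_Z (z : R) := limn (fun J => pgf P' (weighted_count Y J) z).

(* The products of the generating functions of the j Y_j decrease with the
   number of factors. *)
Let cvg_pgf_Z (z : R) : 0 < z < 1 ->
  pgf P' (weighted_count Y J) z @[J --> \oo] --> pgf_Z z.
Proof.
move=> z01; have /andP[z0 z1] := z01.
have pgfE J := pgf_weighted_count rate_ge0 rate0 Y_law Y_indep z01 J.
rewrite /pgf_Z; under eq_fun do rewrite pgfE.
apply: nonincreasing_is_cvgn.
  apply/nonincreasing_seqP => J; rewrite ler_expR lerN2 big_ord_recr/= lerDl.
  by rewrite mulr_ge0// subr_ge0 exprn_ile1 ?ltW.
by exists 0 => _ [J _ <-]; exact: expR_ge0.
Qed.

Let cvg_pgf_Q (z : R) : 0 < z < 1 ->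
  queue_pgf lambda mu N z t @[t --> +oo] --> pgf_Z z.
Proof.
move=> z01; apply: (cvg_queue_pgf lambda_gt0 mu_gt0) => //.
under eq_fun do rewrite -exponentE
  -(pgf_weighted_count rate_ge0 rate0 Y_law Y_indep z01).
exact: cvg_pgf_Z.
Qed.

Let cvg_pmf k : nat_pmf P (Q t) k @[t --> +oo] --> nat_pmf P' Z k.
Proof.
apply: (pgf_continuity (p := fun t => nat_pmf P (Q t)) (p' := nat_pmf P' Z)
  (G := fun t z => queue_pgf lambda mu N z t) (G' := pgf_Z)).
- move=> t z m z01; have /andP[z0 z1] := z01.
  apply: (@count_limit_pgf _ _ _ P (count_present tau N S t) (Q t)).
  + exact: measurable_count_present.
  + exact: count_present_homo.
  + exact: cvg_count_present.
  + by rewrite !ltW.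
  + exact: cvg_pgf_count_present.
- move=> z m z01; have /andP[z0 z1] := z01.
  apply: (@count_limit_pgf _ _ _ P' (weighted_count Y) Z).
  + exact: measurable_weighted_count.
  + exact: weighted_count_homo.
  + exact: cvg_weighted_count.
  + by rewrite !ltW.
  + exact: cvg_pgf_Z.
- exact: cvg_pgf_Q.
Qed.

Let Z_range w : Z w = +oo%E \/ exists n : nat, Z w = n%:R%:E.
Proof.
apply: (count_limit_range (q := weighted_count Y)).
- exact: weighted_count_homo.
- exact: cvg_weighted_count.
Qed.

Lemma measurable_weighted_sum : measurable_fun setT Z.
Proof.
apply: (measurable_count_limit (q := weighted_count Y)).
- exact: measurable_weighted_count.
- exact: cvg_weighted_count.
Qed.

Lemma limiting_distribution_weighted_sum : limiting_distribution P P' Q Z.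
Proof.
split=> // n.
have mQ t : measurable (Q t @^-1` [set n%:R%:E]).
  apply: (measurable_count_limit_atom (q := count_present tau N S t)).
  - exact: measurable_count_present.
  - exact: cvg_count_present.
have mZ : measurable (Z @^-1` [set n%:R%:E]).
  by rewrite -[X in measurable X]setTI; exact: measurable_weighted_sum.
rewrite -[P' _]fineK ?fin_num_measure//.
under eq_fun do rewrite -[P _]fineK ?fin_num_measure//.
by apply: cvg_EFin; [near=> t|exact: cvg_pmf].
Unshelve. all: by end_near. Qed.

Lemma limiting_distribution_unique (d'' : measure_display)
    (T'' : measurableType d'') (P'' : probability T'' R)
    (Qinf : {RV P'' >-> \bar R}) :
  limiting_distribution P P'' Q Qinf -> eq_law P'' P' Qinf Z.
Proof.
move=> [Qr Qlim]; apply: eq_law_atoms => //.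
- exact: measurable_weighted_sum.
- move=> n; have [_ Zlim] := limiting_distribution_weighted_sum.
  by rewrite -(cvg_lim _ (Qlim n))// -(cvg_lim _ (Zlim n)).
Qed.

End steady_state.

Theorem corollary3p9 (R : realType) (lambda mu : R)
    (lambda_gt0 : 0 < lambda) (mu_gt0 : 0 < mu)
    (d : measure_display) (T : measurableType d) (P : probability T R)
    (tau : nat -> {RV P >-> R}) (N : nat -> {RV P >-> nat})
    (S : nat -> nat -> {RV P >-> R})
    (queue : MNMinfty_queue tau N S lambda mu)
    (d' : measure_display) (T' : measurableType d') (P' : probability T' R)
    (Y : nat -> {RV P' >-> nat})
    (Y_law : forall j, (0 < j)%N ->
       has_law (Y j) (Pois (lambda / (j%:R * mu) * batch_tail N j)))
    (Y_indep : mutual_independence P' [set j | (0 < j)%N]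
       (fun j => g_sigma_algebra_preimage (Y j))) :
  limiting_distribution P P' (number_in_system tau N S)
    (weighted_sum R Y)
  /\
  forall (d'' : measure_display) (T'' : measurableType d'')
      (P'' : probability T'' R) (Qinf : {RV P'' >-> \bar R}),
    limiting_distribution P P'' (number_in_system tau N S) Qinf ->
    eq_law P'' P' Qinf (weighted_sum R Y).
Proof.
split.
  exact: (limiting_distribution_weighted_sum lambda_gt0 mu_gt0 queue).
exact: (limiting_distribution_unique lambda_gt0 mu_gt0 queue).
Qed.
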